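(* Suppose that the following three assumptions hold. (i) There is an infinite set $\mathcal{N}$ of positive integers such that for every $n\in\mathcal{N}$, when all elliptic curves $E$ over $\mathbb{Q}$ are ordered by height, the average size of the $n$-Selmer group $S_n(E)$ is $\sigma(n)$, the sum of the positive divisors of $n$. (ii) The root numbers of elliptic curves over $\mathbb{Q}$ are equidistributed: when elliptic curves are ordered by height, $50\%$ have root number $+1$ and $50\%$ have root number $-1$. (iii) The parity conjecture holds: an elliptic curve over $\mathbb{Q}$ has even rank if and only if its root number is $1$. Then, when elliptic curves over $\mathbb{Q}$ are ordered by height, $50\%$ have rank $0$ and $50\%$ have rank $1$.
   Context: Any elliptic curve $E$ over $\mathbb{Q}$ is isomorphic to a unique curve $E_{A,B}:y^2=x^3+Ax+B$ with $A,B\in\mathbb{Z}$ such that for every prime $p$: $p^6\nmid B$ whenever $p^4\mid A$. The (naive) height is $H(E_{A,B}):=\max\{4|A^3|,27B^2\}$. ''When ordered by height, $c\%$ have property $P$'' means that the proportion, among isomorphism classes of elliptic curves over $\mathbb{Q}$ with $H(E)<X$, of those with property $P$ tends to $c/100$ as $X\to\infty$; likewise ''the average of $\#S_n(E)$ is $\sigma(n)$'' means $\sum_{H(E)<X}\#S_n(E)/\sum_{H(E)<X}1\to\sigma(n)$ as $X\to\infty$. $S_n(E)$ denotes the $n$-Selmer group of $E$ over $\mathbb{Q}$; rank means the rank of $E(\mathbb{Q})$. *)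

(* Defs.v *)
From HB Require Import structures.
From mathcomp Require Import all_boot all_order all_algebra all_field.
From mathcomp Require Import finmap.
From mathcomp Require Import all_classical all_reals all_analysis.
From mathcomp Require Import complex.

Set Implicit Arguments.
Unset Strict Implicit.
Unset Printing Implicit Defensive.

Import Order.TTheory GRing.Theory Num.Theory.
Import numFieldNormedType.Exports.

Local Open Scope classical_set_scope.
Local Open Scope ring_scope.

(** * Elliptic curves over Q, ordered by height *)

(* The pair E = (A, B) stands for E_{A,B} : y^2 = x^3 + A x + B.  Isomorphism
   classes of elliptic curves over Q are in bijection with the pairs
   satisfying [elliptic]. *)
Definition elliptic (E : int * int) : Prop :=
  4 * E.1 ^+ 3 + 27 * E.2 ^+ 2 != 0 /\
  forall p : nat, prime p ->
    (p%:Z ^+ 4 %| E.1)%Z -> ~~ (p%:Z ^+ 6 %| E.2)%Z.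

Definition height (E : int * int) : int :=
  Num.max (4 * `|E.1 ^+ 3|) (27 * E.2 ^+ 2).

Section Statistics.
Variable R : realType.

Definition curves_below (X : R) : set (int * int) :=
  [set E | elliptic E /\ (height E)%:~R < X].

Definition num_below (X : R) (P : set (int * int)) : R :=
  #|` fset_set (curves_below X `&` P) |%:R.

Definition percent_have (c : R) (P : set (int * int)) : Prop :=
  num_below X P / num_below X setT @[X --> +oo] --> c / 100.

(* f may take the value +oo, so that no finiteness of the quantity being
   averaged is built in. *)
Definition average_is (f : int * int -> \bar R) (l : R) : Prop :=
  ((num_below X setT)^-1%:E * \esum_(E in curves_below X) f E)%E
    @[X --> +oo] --> l%:E.

End Statistics.

(** * Points and the chord-tangent law *)

(* None is the point at infinity. *)
Definition point (K : fieldType) : Type := option (K * K).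

Section GroupLaw.
Variables (K : fieldType) (E : int * int).

Definition on_curve (P : point K) : Prop :=
  if P is Some (x, y) then y ^+ 2 = x ^+ 3 + E.1%:~R * x + E.2%:~R else True.

Definition opp_pt (P : point K) : point K :=
  if P is Some (x, y) then Some (x, - y) else None.

Definition add_pt (P Q : point K) : point K :=
  match P, Q with
  | None, _ => Q
  | _, None => P
  | Some (x1, y1), Some (x2, y2) =>
      if (x1 == x2) && (y1 == - y2) then None else
      let m := if x1 == x2 then (3 * x1 ^+ 2 + E.1%:~R) / (2 * y1)
               else (y2 - y1) / (x2 - x1) in
      let x3 := m ^+ 2 - x1 - x2 in
      Some (x3, m * (x1 - x3) - y1)
  end.

Definition mul_pt (m : int) (P : point K) : point K :=
  match m with
  | Posz k => iter k (add_pt P) None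
  | Negz k => opp_pt (iter k.+1 (add_pt P) None)
  end.

Definition torsion_pt (n : nat) (P : point K) : Prop :=
  on_curve P /\ mul_pt n P = None.

End GroupLaw.

Definition map_pt (K L : fieldType) (f : K -> L) (P : point K) : point L :=
  if P is Some (x, y) then Some (f x, f y) else None.

(** * Rank *)

Definition independent_pts (E : int * int) (r : nat) (P : 'I_r -> point rat)
    : Prop :=
  forall m : 'I_r -> int,
    \big[add_pt E/None]_(i < r) mul_pt E (m i) (P i) = None ->
    forall i, m i = 0.

Definition has_independent_pts (E : int * int) (r : nat) : Prop :=
  exists P : 'I_r -> point rat,
    (forall i, on_curve E (P i)) /\ independent_pts E P.

Definition has_rank (E : int * int) (r : nat) : Prop :=
  has_independent_pts E r /\ ~ has_independent_pts E r.+1.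

Definition has_even_rank (E : int * int) : Prop :=
  exists2 r, has_rank E r & ~~ odd r.

(** * Selmer groups *)

(* Qbar is algC, and Gal(Qbar/Q) is the type of ring endomorphisms of algC:
   all of them fix Q and are bijective. *)
Notation galQ := {rmorphism algC -> algC}.

Section Selmer.
Variables (E : int * int) (n : nat).

(* Locally constant for the Krull topology on galQ. *)
Definition continuous_cochain (c : galQ -> point algC) : Prop :=
  forall s : galQ, exists S : seq algC,
    forall t : galQ, {in S, s =1 t} -> c t = c s.

Definition cocycle (c : galQ -> point algC) : Prop :=
  [/\ forall s, torsion_pt E n (c s),
      forall s t : galQ, c (s \o t) = add_pt E (c s) (map_pt s (c t))
    & continuous_cochain c].

Definition cohomology_class (c : galQ -> point algC)
    : set (galQ -> point algC) :=
  [set c' | cocycle c' /\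
     exists2 T, torsion_pt E n T &
       forall s : galQ,
         c' s = add_pt E (c s) (add_pt E (map_pt s T) (opp_pt T))].

Variable R : realType.

Definition abs_value (K : fieldType) (v : K -> R) : Prop :=
  [/\ forall x, 0 <= v x,
      forall x, v x = 0 <-> x = 0,
      forall x y, v (x * y) = v x * v y
    & forall x y, v (x + y) <= v x + v y].

(* A place of Q, given by a nontrivial absolute value. *)
Definition place (w : rat -> R) : Prop :=
  abs_value w /\ exists2 q, q != 0 & w q <> 1.

Definition complete_abs (K : fieldType) (v : K -> R) : Prop :=
  forall u : nat -> K,
    (forall e, 0 < e -> exists N, forall i j, (N <= i)%N -> (N <= j)%N ->
       v (u i - u j) < e) ->
    exists l, forall e, 0 < e -> exists N, forall i, (N <= i)%N ->
       v (u i - l) < e.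

Definition completion (w : rat -> R) (K : fieldType) (v : K -> R) : Prop :=
  [/\ abs_value v,
      forall q : rat, v (ratr q) = w q,
      forall (x : K) e, 0 < e -> exists q : rat, v (x - ratr q) < e
    & complete_abs v].

(* The image of c in H^1(Q_w, E(Qbar_w)) vanishes for every place w.  Here
   (K, v) is Q_w, L is an algebraic closure of K, and j : Qbar -> L.  Such
   (K, v), L and j exist and the condition does not depend on their choice, so
   it is asked for all of them.  The restriction along j of an element s of
   Gal(L/K) is the t with s \o j = j \o t; and a K-endomorphism s of L is
   bijective since L is algebraic over K. *)
Definition locally_trivial (c : galQ -> point algC) : Prop :=
  forall (w : rat -> R), place w ->
  forall (K : fieldType) (v : K -> R), completion w v ->
  forall (L : closedFieldType) (i : {rmorphism K -> L}),
    (forall x, algebraicOver i x) ->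
  forall (j : {rmorphism algC -> L}),
  exists2 P : point L, on_curve E P &
    forall s : {rmorphism L -> L}, (forall x, s (i x) = i x) ->
    forall t : galQ, (forall x, s (j x) = j (t x)) ->
      map_pt j (c t) = add_pt E (map_pt s P) (opp_pt P).

(* S_n(E) = ker (H^1(Q, E[n]) -> \prod_w H^1(Q_w, E)), as a set of classes. *)
Definition selmer : set (set (galQ -> point algC)) :=
  [set cohomology_class c | c in [set c | cocycle c /\ locally_trivial c]].

End Selmer.

Definition selmer_size (R : realType) (n : nat) (E : int * int) : \bar R :=
  counting (selmer E n R).

(** * Root numbers *)

(* y^2 + a1 x y + a3 y = x^3 + a2 x^2 + a4 x + a6 *)
Record weierstrass := Weierstrass { a1 : int; a2 : int; a3 : int;
                                    a4 : int; a6 : int }.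

Definition discr (W : weierstrass) : int :=
  let b2 := a1 W ^+ 2 + 4 * a2 W in
  let b4 := 2 * a4 W + a1 W * a3 W in
  let b6 := a3 W ^+ 2 + 4 * a6 W in
  let b8 := a1 W ^+ 2 * a6 W + 4 * a2 W * a6 W - a1 W * a3 W * a4 W
            + a2 W * a3 W ^+ 2 - a4 W ^+ 2 in
  - (b2 ^+ 2 * b8) - 8 * b4 ^+ 3 - 27 * b6 ^+ 2 + 9 * b2 * b4 * b6.

(* The substitution x = u^2 x' + r, y = u^3 y' + s u^2 x' + t turns the
   equation of E into that of W. *)
Definition integral_model (E : int * int) (W : weierstrass) : Prop :=
  exists u r s t : rat, u != 0 /\
  [/\ u * (a1 W)%:~R = 2 * s,
      u ^+ 2 * (a2 W)%:~R = 3 * r - s ^+ 2,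
      u ^+ 3 * (a3 W)%:~R = 2 * t,
      u ^+ 4 * (a4 W)%:~R = E.1%:~R + 3 * r ^+ 2 - 2 * s * t
    & u ^+ 6 * (a6 W)%:~R = E.2%:~R + r * E.1%:~R + r ^+ 3 - t ^+ 2].

(* Global minimal model: v_p(discr W) is minimal at every prime p. *)
Definition minimal_model (E : int * int) (W : weierstrass) : Prop :=
  integral_model E W /\
  forall W', integral_model E W' ->
  forall p, prime p -> (logn p `|discr W| <= logn p `|discr W'|)%N.

Definition affine_points (W : weierstrass) (p : nat) : {set 'F_p * 'F_p} :=
  [set z | z.2 ^+ 2 + (a1 W)%:~R * z.1 * z.2 + (a3 W)%:~R * z.2
           == z.1 ^+ 3 + (a2 W)%:~R * z.1 ^+ 2 + (a4 W)%:~R * z.1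
              + (a6 W)%:~R]%SET.

(* a_p = p + 1 - #W(F_p), the reduced curve having one point at infinity and
   its singular point, if any, being counted; thus a_p is 1, -1 or 0 when the
   reduction is split multiplicative, nonsplit multiplicative or additive. *)
Definition trace_frob (W : weierstrass) (p : nat) : int :=
  p%:Z - #|affine_points W p|%:Z.

Section RootNumber.
Variable R : realType.
Local Notation C := (R[i] : numClosedFieldType).
Local Open Scope complex_scope.

(* x ^ s for x > 0 *)
Definition cpow (x : R) (s : C) : C :=
  (expR (complex.Re s * ln x))%:C *
  (cos (complex.Im s * ln x) +i* sin (complex.Im s * ln x)).

(* Euler's integral for Gamma(s), Re s > 0: t^(s-1) e^(-t) over t > 0. *)
Definition cGamma (s : C) : C :=
  Rintegral lebesgue_measure `]0, +oo[
    (fun t : R => complex.Re (cpow t (s - 1)) * expR (- t)) +i*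
  Rintegral lebesgue_measure `]0, +oo[
    (fun t : R => complex.Im (cpow t (s - 1)) * expR (- t)).

Definition euler_factor (W : weierstrass) (p : nat) (s : C) : C :=
  (1 - (trace_frob W p)%:~R * cpow p%:R (- s)
     + (~~ (p%:Z %| discr W)%Z)%:R * cpow p%:R (1 - 2 * s))^-1.

Definition L_value (W : weierstrass) (s l : C) : Prop :=
  (\prod_(p < n | prime p) euler_factor W p s : C^o) @[n --> \oo] --> (l : C^o).

(* The root number of E is the sign w in the functional equation
   Lambda(2 - s) = w Lambda(s) of the entire function continuing
   N^(s/2) (2 pi)^(-s) Gamma(s) L(E, s).  As L(E, s) is not identically zero,
   the equation determines both w and N (the conductor of E). *)
Definition has_root_number (w : int) (E : int * int) : Prop :=
  (w = 1 \/ w = -1) /\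
  exists (W : weierstrass) (N : nat) (Lambda : C^o -> C^o),
    [/\ minimal_model E W, (0 < N)%N,
        forall s, derivable Lambda s 1,
        forall s : C, 3 / 2 < complex.Re s -> exists2 l : C, L_value W s l &
          Lambda s = cpow N%:R (s / 2) * cpow (2 * pi) (- s) * cGamma s * l
      & forall s : C, Lambda (2 - s) = w%:~R * Lambda s].

End RootNumber.

(* Main.v *)
(* A curve E with two independent rational points satisfies #S_n(E) >= n^2.
   Granting this, the average sigma(n) bounds the upper density of such curves
   by sigma(n) / n^2, which tends to 0 along an infinite set of n; so almost all
   curves have rank 0 or 1, and parity together with the equidistribution of
   root numbers splits them evenly.

   The bound #S_n(E) >= n^2 follows from the Kummer map, which sends P in E(Q) to
   the class of s |-> s(Q) - Q with nQ = P and embeds E(Q)/nE(Q) in S_n(E), and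
   from #(E(Q)/nE(Q)) >= n^2.  The latter does not need the Mordell-Weil theorem:
   were there k < n^2 cosets, then P = R + nS with R among k representatives and
   S of height about h(P)/n^2 would bound the number of points of height at most
   T by O(T^a) with a < 1, whereas two independent points produce at least a
   constant times T of them.

   Associativity of the chord-tangent law is read off from ideal classes of the
   coordinate ring K[X, Y] / (Y^2 - X^3 - aX - b): P |-> (X - x, Y - y) is
   compatible with sums, and it is injective on classes because the norm of no
   element has degree 1. *)

From HB Require Import structures.
Require Import Defs.
From mathcomp Require Import all_boot all_order all_algebra all_field.
From mathcomp Require Import all_classical all_reals all_analysis.
From mathcomp Require Import finmap ring lra zify.

Set Implicit Arguments.
Unset Strict Implicit.
Unset Printing Implicit Defensive.

Import Order.TTheory GRing.Theory Num.Theory.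
Import numFieldNormedType.Exports.

Local Open Scope classical_set_scope.
Local Open Scope ring_scope.

(** The Kummer map presupposes that nQ = P is solvable over Qbar. Division polynomials are avoided:
    a point P1 of infinite order, which two independent points supply, forces multiplication by n to
    be a nonconstant rational function of x, hence to reach all points outside finitely many
    abscissae; translation by multiples of nP1 then reaches the rest. On the height side there is no
    canonical height, only a parallelogram inequality and a lower bound at 2P, both up to a
    constant. They cost a factor 2 in the descent, so with k < n^2 cosets n is first replaced by a
    power n^j for which (n^2 / k)^j is at least 4. *)

Local Notation ecpoint := Defs.point.

(** * The coordinate ring as a quadratic extension of K[X] *)

Section QuadraticExtension.
Variable K : fieldType.

(* The pair (f, g) stands for f + g Y in K[X][Y] / (Y^2 - W). *)
Definition quad_ext (W : {poly K}) : Type := ({poly K} * {poly K})%type.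

Variable W : {poly K}.
Local Notation quad := (quad_ext W).

HB.instance Definition _ := GRing.Zmodule.copy quad ({poly K} * {poly K})%type.

Definition quad_one : quad := (1, 0).
Definition quad_mul (u v : quad) : quad :=
  (u.1 * v.1 + W * u.2 * v.2, u.1 * v.2 + u.2 * v.1).

Fact quad_mulA : associative quad_mul.
Proof. by move=> [a b] [c d] [e f]; congr pair => /=; ring. Qed.
Fact quad_mulC : commutative quad_mul.
Proof. by move=> [a b] [c d]; congr pair => /=; ring. Qed.
Fact quad_mul1 : left_id quad_one quad_mul.
Proof. by move=> [a b]; congr pair => /=; ring. Qed.
Fact quad_mulD : left_distributive quad_mul +%R.
Proof. by move=> [a b] [c d] [e f]; congr pair => /=; ring. Qed.
Fact quad_1neq0 : quad_one != 0.
Proof. by rewrite -pair_eqE /= /pair_eq /= oner_eq0. Qed.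

HB.instance Definition _ :=
  GRing.Zmodule_isComNzRing.Build quad quad_mulA quad_mulC quad_mul1 quad_mulD quad_1neq0.

Lemma quadME (u v : quad) :
  u * v = (u.1 * v.1 + W * u.2 * v.2, u.1 * v.2 + u.2 * v.1).
Proof. by []. Qed.

Definition quad_norm (u : quad) : {poly K} := u.1 ^+ 2 - W * u.2 ^+ 2.

Lemma quad_normM u v : quad_norm (u * v) = quad_norm u * quad_norm v.
Proof. by rewrite quadME /quad_norm /=; ring. Qed.

Hypothesis sizeW : size W = 4%N.

(** Since W has degree 3, f^2 has even degree and W g^2 odd degree, so leading terms cannot cancel.
    Hence only 0 has norm 0, the ring is a domain, and no norm has degree 1. *)
Lemma size_quad_norm (u : quad) :
  size (quad_norm u) =
    maxn (if u.1 == 0 then 0 else (size u.1).*2.-1) (if u.2 == 0 then 0 else (size u.2).*2.+2).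
Proof.
case: u => f g; rewrite /quad_norm /=.
have sf : size (f ^+ 2) = if f == 0 then 0 else (size f).*2.-1.
  case: eqP => [->|/eqP f0]; first by rewrite expr0n size_poly0.
  by rewrite expr2 size_mul // addnn.
have sg : size (- (W * g ^+ 2)) = if g == 0 then 0 else (size g).*2.+2.
  rewrite size_polyN; case: eqP => [->|/eqP g0]; first by rewrite expr0n /= mulr0 size_poly0.
  rewrite size_mul ?expf_neq0 // -?size_poly_eq0 ?sizeW // expr2 size_mul // addnn.
  by have := size_poly_eq0 g; rewrite (negPf g0); case: (size g).
have [->|f0] := eqVneq f 0.
  by rewrite expr0n /= sub0r max0n sg.
have [->|g0] := eqVneq g 0.
  by rewrite expr0n /= mulr0 subr0 maxn0 sf (negPf f0).
rewrite (negPf f0) in sf; rewrite (negPf g0) in sg.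
have odd1 : odd (size (f ^+ 2)).
  by rewrite sf; move: f0; rewrite -size_poly_gt0; lia.
have odd2 : ~~ odd (size (- (W * g ^+ 2))) by rewrite sg; lia.
rewrite -sf -sg; case: (ltngtP (size (f ^+ 2)) (size (- (W * g ^+ 2)))) => H.
- by rewrite addrC size_polyDl //; lia.
- by rewrite size_polyDl //; lia.
- by move: odd1 odd2; rewrite H => ->.
Qed.

Lemma quad_norm_eq0 u : (quad_norm u == 0) = (u == 0).
Proof.
rewrite -size_poly_eq0 size_quad_norm; case: u => f g /=.
rewrite -pair_eqE /pair_eq /=.
case: (eqVneq f 0) => [_|]; case: (eqVneq g 0) => [_|] //=;
  rewrite -?size_poly_gt0 ?maxn0; case: (size f) => //=; lia.
Qed.

Lemma quad_mulI (c u v : quad) : c != 0 -> c * u = c * v -> u = v.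
Proof.
move=> c0 /(congr1 (fun z => z - c * v)); rewrite subrr -mulrBr => /eqP.
rewrite -quad_norm_eq0 quad_normM mulf_eq0 !quad_norm_eq0 (negPf c0) /= subr_eq0.
by move/eqP.
Qed.

Lemma quad_mul_neq0 (u v : quad) : u != 0 -> v != 0 -> u * v != 0.
Proof. by rewrite -!quad_norm_eq0 quad_normM mulf_eq0 => /negPf-> /negPf->. Qed.

Lemma size_quad_norm_neq2 u : size (quad_norm u) <> 2%N.
Proof.
rewrite size_quad_norm; case: u => f g /=.
case: (eqVneq f 0) => [_|]; case: (eqVneq g 0) => [_|] //=;
  rewrite -?size_poly_gt0 ?maxn0; case: (size f) => [|m] //=; case: (size g) => [|k] //=; lia.
Qed.

Lemma size_quad_norm1 u : size (quad_norm u) = 1%N -> exists2 k : K, k != 0 & u = (k%:P, 0).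
Proof.
rewrite size_quad_norm; case: u => f g /=.
case: (eqVneq g 0) => [->|g0]; last by case: (eqVneq f 0); lia.
case: (eqVneq f 0) => [_|f0] //; rewrite maxn0 => H.
have /eqP/size_poly1P[k k0 ->] : size f = 1%N by case: (size f) H; lia.
by exists k.
Qed.

End QuadraticExtension.

(** * Ideals up to principal multiples *)

Section Span.
Variable A : comNzRingType.
Implicit Types S T U : set A.

Inductive span T : set A :=
| span_gen t of T t : span T t
| span0 : span T 0
| spanD u v of span T u & span T v : span T (u + v)
| spanMl c u of span T u : span T (c * u).

Lemma spanN T u : span T u -> span T (- u).
Proof. by move=> hu; rewrite -mulN1r; apply: spanMl. Qed.

Lemma spanB T u v : span T u -> span T v -> span T (u - v).
Proof. by move=> hu hv; apply: spanD => //; apply: spanN. Qed.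

Lemma span_min S T : S `<=` span T -> span S `<=` span T.
Proof.
move=> ST x; elim=> [t /ST //||u v _ hu _ hv|c u _ hu].
- exact: span0.
- exact: spanD.
- exact: spanMl.
Qed.

Lemma span_set1 d x : span [set d] x -> exists c, x = c * d.
Proof.
elim=> [_ ->||u v _ [c ->] _ [e ->]|c u _ [e ->]].
- by exists 1; rewrite mul1r.
- by exists 0; rewrite mul0r.
- by exists (c + e); rewrite mulrDl.
- by exists (c * e); rewrite mulrA.
Qed.

(** Ideals are handled through generators; by [span_setM] these elementwise products generate the
    product of the two ideals. *)
Definition setM S T : set A := [set s * t | s in S & t in T].
Local Infix "**" := setM (at level 40, left associativity).

Lemma setMA : associative setM.
Proof.
move=> S T U; apply/seteqP; split=> x.
  move=> [s Ss [_ [t Tt [u Uu <-]] <-]]; rewrite mulrA; exists (s * t); last by exists u.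
  by exists s => //; exists t.
move=> [_ [s Ss [t Tt <-]] [u Uu <-]]; rewrite -mulrA; exists s => //; exists (t * u) => //.
by exists t => //; exists u.
Qed.

Lemma setMC : commutative setM.
Proof.
by move=> S T; apply/seteqP; split=> x [s Ss [t Tt <-]]; rewrite mulrC; exists t => //; exists s.
Qed.

Lemma set1M c d : [set c] ** [set d] = [set c * d].
Proof.
apply/seteqP; split=> x; first by move=> [_ -> [_ -> <-]].
by move=> ->; exists c => //; exists d.
Qed.

Lemma setM1 S : S ** [set 1] = S.
Proof.
apply/seteqP; split=> x; first by move=> [s Ss [_ -> <-]]; rewrite mulr1.
by move=> Sx; exists x => //; exists 1 => //; rewrite mulr1.
Qed.

Lemma span_setM S T s t : span S s -> span T t -> span (S ** T) (s * t).
Proof.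
move=> hs ht; elim: hs => [{}s Ss||u v _ hu _ hv|c u _ hu].
- elim: ht => [{}t Tt||u v _ hu _ hv|c u _ hu].
  + by apply: span_gen; exists s => //; exists t.
  + by rewrite mulr0; apply: span0.
  + by rewrite mulrDr; apply: spanD.
  + by rewrite mulrCA; apply: spanMl.
- by rewrite mul0r; apply: span0.
- by rewrite mulrDl; apply: spanD.
- by rewrite -mulrA; apply: spanMl.
Qed.

Definition same_span S T := S `<=` span T /\ T `<=` span S.

Lemma same_span_sym S T : same_span S T -> same_span T S.
Proof. by case. Qed.

Lemma same_span_trans S T U : same_span S T -> same_span T U -> same_span S U.
Proof.
move=> [ST TS] [TU UT]; split; first by move=> x /ST; apply: span_min.
by move=> x /UT; apply: span_min.
Qed.

Lemma same_spanM S S' T T' : same_span S S' -> same_span T T' -> same_span (S ** T) (S' ** T').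
Proof.
move=> [SS' S'S] [TT' T'T].
by split=> x [s ? [t ? <-]]; apply: span_setM; auto.
Qed.

Lemma same_span_refl S : same_span S S.
Proof. by split; apply: span_gen. Qed.

(** The multiplier d / c relating the two ideals lives in the fraction field; it is kept as a pair
    of nonzero ring elements. *)
Definition same_class S T := exists c d, [/\ c != 0, d != 0 &
  same_span ([set c] ** S) ([set d] ** T)].

Lemma same_span_class S T : same_span S T -> same_class S T.
Proof.
move=> ST; exists 1, 1; rewrite oner_eq0; split=> //; apply: same_spanM => //.
exact: same_span_refl.
Qed.

Lemma same_class_sym S T : same_class S T -> same_class T S.
Proof. by move=> [c [d [c0 d0 ST]]]; exists d, c; split=> //; apply: same_span_sym. Qed.

Lemma same_classM S T U : same_class S T -> same_class (S ** U) (T ** U).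
Proof.
move=> [c [d [c0 d0 ST]]]; exists c, d; split=> //; rewrite !setMA.
by apply: same_spanM => //; apply: same_span_refl.
Qed.

Hypothesis mul_neq0 : forall u v : A, u != 0 -> v != 0 -> u * v != 0.

Lemma same_class_trans S T U : same_class S T -> same_class T U -> same_class S U.
Proof.
move=> [c [d [c0 d0 ST]]] [c' [d' [c0' d0' TU]]].
exists (c' * c), (d * d'); split; rewrite ?mul_neq0 // -!set1M -!setMA.
apply: (@same_span_trans _ ([set c'] ** ([set d] ** T))).
  by apply: same_spanM => //; apply: same_span_refl.
rewrite setMA (setMC [set c']) -setMA.
by apply: same_spanM => //; apply: same_span_refl.
Qed.

(* If z = Y - l is the function cutting the line through two points of
   abscissae roots of x1 and x2, and z' = Y + l, the hypothesis zz' says that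
   x3 vanishes at the third intersection point. *)
Lemma line_span (x1 x2 x3 z z' : A) : z * z' = x1 * x2 * x3 ->
  span ([set x1; z] ** [set x2; z]) z ->
  same_span ([set x3] ** ([set x1; z] ** [set x2; z])) ([set z] ** [set x3; z']).
Proof.
move=> zz' hz; have gen1 : span ([set z] ** [set x3; z']) (z * x3).
  by apply: span_gen; exists z => //; exists x3; first by left.
split=> x.
  move=> [_ -> [_ [s [->|->] [t [->|->] <-]] <-]].
  - have -> : x3 * (x1 * x2) = z * z' by rewrite zz'; ring.
    by apply: span_gen; exists z => //; exists z'; first by right.
  - have -> : x3 * (x1 * z) = x1 * (z * x3) by ring.
    exact: spanMl.
  - have -> : x3 * (z * x2) = x2 * (z * x3) by ring.
    exact: spanMl.
  - have -> : x3 * (z * z) = z * (z * x3) by ring.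
    exact: spanMl.
move=> [_ -> [t [->|->] <-]].
  by rewrite mulrC; apply: span_setM => //; apply: span_gen.
rewrite zz' mulrC; apply: span_setM; apply: span_gen => //.
by exists x1; [left | exists x2; first by left].
Qed.

End Span.

(** * Ideal classes of points *)

Section PointClass.
Variables (K : fieldType) (a b : K).

Definition cubic : {poly K} := 'X^3 + a%:P * 'X + b%:P.

Lemma size_cubic : size cubic = 4%N.
Proof.
rewrite /cubic -addrA size_polyDl ?size_polyXn //.
rewrite (leq_ltn_trans (size_polyD _ _)) // gtn_max.
rewrite (leq_ltn_trans (size_polyC_leq1 _)) // andbT.
by rewrite mul_polyC (leq_ltn_trans (size_scale_leq _ _)) // size_polyX.
Qed.

Lemma horner_cubic x : cubic.[x] = x ^+ 3 + a * x + b.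
Proof. by rewrite /cubic !hornerE. Qed.

Local Notation A := (quad_ext cubic).
Local Infix "**" := setM (at level 40, left associativity).
Local Infix "~~~" := same_class (at level 70).

Let mul_neq0 := @quad_mul_neq0 K cubic size_cubic.
Let cls_trans := same_class_trans mul_neq0.

Definition xgen (x : K) : A := ('X - x%:P, 0).
Definition ygen (l : {poly K}) : A := (- l, 1).

Definition pt_gens (P : ecpoint K) : set A :=
  if P is Some (x, y) then [set xgen x; ygen y%:P] else [set 1].

Lemma xgen_neq0 x : xgen x != 0.
Proof. by rewrite -pair_eqE /pair_eq /= polyXsubC_eq0. Qed.

Lemma ygen_neq0 l : ygen l != 0.
Proof. by rewrite -pair_eqE /pair_eq /= oner_eq0 andbF. Qed.

Lemma span_xgen (S : set A) (x : K) (c : A) (f g : {poly K}) :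
  span S (xgen x) -> span S (ygen f) -> f.[x] = g.[x] -> span S (ygen g).
Proof.
move=> hx hf /eqP; rewrite -subr_eq0 -hornerN -hornerD => /factor_theorem[q qE].
have -> : ygen g = ygen f + ((q, 0) : A) * xgen x.
  rewrite quadME /=; congr pair => /=; last by ring.
  rewrite mulr0 addr0 -qE; ring.
by apply: spanD => //; apply: spanMl.
Qed.

(** Modulo X - x a polynomial is its value at x. So in the ideal of a point, Y - y may be replaced
    by the equation of any line through the point. *)
Lemma same_span_line x (f g : {poly K}) : f.[x] = g.[x] ->
  same_span [set xgen x; ygen f] [set xgen x; ygen g].
Proof.
by move=> fg; split=> u [->|->]; try (by apply: span_gen; left);
  [apply: (@span_xgen _ x 0 g) | apply: (@span_xgen _ x 0 f)] => //;
  by apply: span_gen; (left + right).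
Qed.

Hypothesis nonsing : 2 * (4 * a ^+ 3 + 27 * b ^+ 2) != 0 :> K.

Lemma two_neq0 : 2 != 0 :> K.
Proof. by apply: contraNneq nonsing => ->; rewrite mul0r. Qed.

Lemma simple_root x : x ^+ 3 + a * x + b = 0 -> 3 * x ^+ 2 + a != 0.
Proof.
move=> W0; apply: contraNneq nonsing => W'0.
(* The resultant of W and W' written as a combination of the two. *)
have -> : 4 * a ^+ 3 + 27 * b ^+ 2 =
  (3 * x ^+ 2 + a) * (4 * a ^+ 2 + 6 * a * x ^+ 2 - 9 * b * x)
  + (x ^+ 3 + a * x + b) * (27 * b - 18 * a * x) by ring.
by rewrite W0 W'0 !mul0r addr0 mulr0.
Qed.

(** All products of generators are multiples of X - x, as (Y - y)(Y + y) = W - y^2 vanishes at x.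
    Conversely X - x is recovered from 2y(X - x) if y is nonzero, and otherwise because q(x) = W'(x)
    is nonzero. *)
Lemma opp_class x y : y ^+ 2 = x ^+ 3 + a * x + b ->
  pt_gens (Some (x, y)) ** pt_gens (Some (x, - y)) ~~~ [set 1].
Proof.
move=> onC; pose X := xgen x.
have /factor_theorem[q qE] : root (cubic - (y ^+ 2)%:P) x.
  by rewrite /root !hornerE -onC subrr.
have yyE : ygen y%:P * ygen (- y)%:P = ((q, 0) : A) * X.
  rewrite !quadME /=; congr pair => /=; last by rewrite polyCN; ring.
  by rewrite !mulr0 addr0 -qE polyCN polyC_exp; ring.
exists 1, X; split; rewrite ?oner_eq0 ?xgen_neq0 // setMC !setM1; split=> u.
  move=> [s [->|->] [t [->|->] <-]].
  - by apply/spanMl/span_gen.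
  - by rewrite mulrC; apply/spanMl/span_gen.
  - by apply/spanMl/span_gen.
  - by rewrite yyE; apply/spanMl/span_gen.
move=> ->; set T := (T in span T).
have TXX : span T (X * X).
  by apply: span_gen; exists X; [left | exists X; first by left].
have [y0|y0] := eqVneq y 0.
  have q0 : q.[x] != 0.
    have d1 : (cubic - (y ^+ 2)%:P)^`().[x] = q.[x].
      rewrite qE derivM derivXsubC mulr1 !hornerE subrr mulr0 add0r.
      by [].
    have d2 : (cubic - (y ^+ 2)%:P)^`().[x] = 3 * x ^+ 2 + a.
      rewrite /cubic derivB !derivD derivXn derivM !derivC derivX !hornerE /=.
      ring.
    by rewrite -d1 d2; apply: simple_root; rewrite -onC y0 expr0n.
  have /factor_theorem[r rE] : root (q - q.[x]%:P) x.
    by rewrite /root !hornerE subrr.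
  have -> : X = (((q.[x])^-1%:P, 0) : A) *
               (ygen y%:P * ygen (- y)%:P - ((r, 0) : A) * (X * X)).
    rewrite yyE mulrA -mulrBl mulrA /X /xgen !quadME /=; congr pair => /=; last by ring.
    rewrite !(mulr0, mul0r, addr0, oppr0) -rE subKr.
    by rewrite -polyCM mulVf // mul1r.
  apply/spanMl/spanB; last exact: spanMl.
  by apply: span_gen; exists (ygen y%:P); [right | exists (ygen (- y)%:P); first by right].
have -> : X = ((((2 * y)^-1)%:P, 0) : A) * (X * ygen (- y)%:P - ygen y%:P * X).
  have -> : X * ygen (- y)%:P - ygen y%:P * X = (((2 * y)%:P, 0) : A) * X.
    rewrite !quadME; congr pair => /=; last by ring.
    by rewrite polyCM polyCN; ring.
  rewrite mulrA /X /xgen !quadME /=; congr pair => /=; last by ring.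
  rewrite !(mulr0, mul0r, addr0) -polyCM mulVf ?mul1r //.
  by rewrite mulf_neq0 // two_neq0.
apply/spanMl/spanB; apply: span_gen.
  by exists X; [left | exists (ygen (- y)%:P); first by right].
by exists (ygen y%:P); [right | exists X; first by left].
Qed.

(** For equal abscissae the line must be the tangent at a point with y nonzero, the only case left
    when the points are not opposite. *)
Definition slope_of (x1 y1 x2 y2 m : K) : Prop :=
  if x1 == x2 then [/\ y1 = y2, y1 != 0 & 2 * m * y1 = 3 * x1 ^+ 2 + a]
  else m * (x2 - x1) = y2 - y1.

Lemma line_cubic x1 y1 x2 y2 m : slope_of x1 y1 x2 y2 m ->
  y1 ^+ 2 = x1 ^+ 3 + a * x1 + b -> y2 ^+ 2 = x2 ^+ 3 + a * x2 + b ->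
  cubic - (m%:P * 'X + (y1 - m * x1)%:P) ^+ 2 =
  ('X - x1%:P) * ('X - x2%:P) * ('X - (m ^+ 2 - x1 - x2)%:P).
Proof.
move=> sl C1 C2; set x3 := m ^+ 2 - x1 - x2.
(* [al] X + [be] is the difference of the two sides, x3 being chosen to match the coefficients of
   X^2. It vanishes at x1; that [al] is 0 follows from the second root or from tangency. *)
pose al := a - 2 * m * (y1 - m * x1) - (x1 * x2 + x1 * x3 + x2 * x3).
pose be := b - (y1 - m * x1) ^+ 2 + x1 * x2 * x3.
have D1 : al * x1 + be = 0.
  have -> : al * x1 + be = x1 ^+ 3 + a * x1 + b - y1 ^+ 2 by rewrite /al /be /x3; ring.
  by rewrite C1 subrr.
have al0 : al = 0.
  move: sl; rewrite /slope_of; case: eqP => [x12 [_ _ tg]|/eqP x12 sl].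
    have -> : al = 3 * x1 ^+ 2 + a - 2 * m * y1.
      by rewrite /al /x3 -x12; ring.
    by rewrite tg subrr.
  apply: (@mulIf _ (x2 - x1)); first by rewrite subr_eq0 eq_sym.
  rewrite mul0r.
  have -> : al * (x2 - x1) = (al * x2 + be) - (al * x1 + be) by ring.
  have -> : al * x2 + be = x2 ^+ 3 + a * x2 + b - (m * (x2 - x1) + y1) ^+ 2.
    by rewrite /al /be /x3; ring.
  by rewrite D1 sl subrK C2 subrr subr0.
have be0 : be = 0 by move: D1; rewrite al0 mul0r add0r.
have aE : a = 2 * m * (y1 - m * x1) + (x1 * x2 + x1 * x3 + x2 * x3).
  by apply/eqP; rewrite -subr_eq0 -[X in _ == X]al0 /al; apply/eqP; ring.
have bE : b = (y1 - m * x1) ^+ 2 - x1 * x2 * x3.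
  by apply/eqP; rewrite -subr_eq0 -[X in _ == X]be0 /be; apply/eqP; ring.
rewrite /cubic aE bE /x3 !(polyCD, polyCB, polyCM, polyC_exp, polyCN, polyC1).
ring.
Qed.

(** With Z = Y - l, [line_span] multiplies the two ideals to that of (X - x3, Y + l), up to the
    factors X - x3 and Z. This is the ideal of the reflected third intersection point, whose
    ordinate is - l(x3). *)
Lemma chord_class x1 y1 x2 y2 m : slope_of x1 y1 x2 y2 m ->
  y1 ^+ 2 = x1 ^+ 3 + a * x1 + b -> y2 ^+ 2 = x2 ^+ 3 + a * x2 + b ->
  let x3 := m ^+ 2 - x1 - x2 in
  pt_gens (Some (x1, y1)) ** pt_gens (Some (x2, y2)) ~~~
  pt_gens (Some (x3, m * (x1 - x3) - y1)).
Proof.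
move=> sl C1 C2 x3; pose l := m%:P * 'X + (y1 - m * x1)%:P.
have lE : cubic - l ^+ 2 = ('X - x1%:P) * ('X - x2%:P) * ('X - x3%:P).
  exact: line_cubic sl C1 C2.
have lx1 : y1%:P.[x1] = l.[x1] by rewrite /l !(hornerD, hornerM, hornerC, hornerX); ring.
have lx2 : y2%:P.[x2] = l.[x2].
  rewrite /l !(hornerD, hornerM, hornerC, hornerX); move: sl; rewrite /slope_of; case: eqP => [<- [-> _ _]|_ sl]; first by ring.
  have -> : y2 = m * (x2 - x1) + y1 by rewrite sl subrK.
  ring.
pose X1 := xgen x1; pose X2 := xgen x2; pose X3 := xgen x3.
pose Z := ygen l; pose Z' := ygen (- l).
have ZZ' : Z * Z' = X1 * X2 * X3.
  rewrite !quadME /=; congr pair => /=; last by ring.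
  by rewrite !(mulr0, addr0, mul0r, mulr1) -lE; ring.
pose T := [set X1; Z] ** [set X2; Z].
have T1 : span T (X1 * Z).
  by apply: span_gen; exists X1; [left | exists Z; first by right].
have T2 : span T (Z * X2).
  by apply: span_gen; exists Z; [right | exists X2; first by left].
have T3 : span T (Z * Z).
  by apply: span_gen; exists Z; [right | exists Z; first by right].
have T4 : span T (X1 * X2).
  by apply: span_gen; exists X1; [left | exists X2; first by left].
have inv (k : K) (u : A) : k != 0 -> u = (((k^-1)%:P, 0) : A) * (((k%:P, 0) : A) * u).
  move=> k0; rewrite mulrA; have -> : (((k^-1)%:P, 0) : A) * (k%:P, 0) = 1.
    by rewrite quadME /= !(mulr0, mul0r, addr0) -polyCM mulVf.
  by rewrite mul1r.
(* For a chord, X1 - X2 is a nonzero constant. For a tangent, X3 X1 X2 - Z^2 = Z (Z' - Z) = 2 l Z,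
   and l is the constant y1 modulo X1. *)
have hz : span T Z.
  move: sl; rewrite /slope_of; case: eqP => [x12 [_ y10 _]|/eqP x12 _].
    have /factor_theorem[q qE] : root (l - y1%:P) x1 by rewrite /root hornerD hornerN lx1 subrr.
    rewrite (inv (2 * y1) Z) ?mulf_neq0 ?two_neq0 //; apply: spanMl.
    have -> : (((2 * y1)%:P, 0) : A) * Z = X3 * (X1 * X2) - Z * Z - ((2 * q, 0) : A) * (X1 * Z).
      have -> : X3 * (X1 * X2) = Z * Z' by rewrite ZZ'; ring.
      have -> : Z' = Z + ((2 * l, 0) : A) by congr pair => /=; ring.
      have -> : l = q * ('X - x1%:P) + y1%:P by rewrite -qE subrK.
      rewrite !(polyCM, polyCD, polyC1).
      rewrite !quadME; congr pair => /=; ring.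
    exact: spanB (spanB (spanMl _ T4) T3) (spanMl _ T1).
  rewrite (inv (x2 - x1) Z) ?subr_eq0 1?eq_sym //; apply: spanMl.
  have -> : (((x2 - x1)%:P, 0) : A) * Z = X1 * Z - Z * X2.
    by rewrite polyCB !quadME; congr pair => /=; ring.
  exact: spanB T1 T2.
exists X3, Z; split; rewrite ?xgen_neq0 ?ygen_neq0 //.
apply: (same_span_trans _ (same_span_trans (line_span ZZ' hz) _)).
  apply: same_spanM; first exact: same_span_refl.
  by apply: same_spanM; apply: same_span_line.
apply: same_spanM; first exact: same_span_refl.
apply: same_span_line; rewrite /l !(hornerN, hornerD, hornerM, hornerC, hornerX); ring.
Qed.

(** A generator e would have norm dividing (X - x)^2, so of degree 0 or 2. In the first case e is a
    nonzero constant, which does not vanish at the point; in the second it is a constant multiple of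
    X - x, which does not divide Y - y. *)
Lemma affine_not_principal x y : y ^+ 2 = x ^+ 3 + a * x + b ->
  ~ (pt_gens (Some (x, y)) ~~~ [set 1]).
Proof.
move=> onC [c [d [c0 d0]]]; rewrite setM1 => -[sub sup].
(* Evaluation at (x, y), multiplicative because y^2 = W(x). *)
pose ev (u : A) := u.1.[x] + u.2.[x] * y.
have evM u v : ev (u * v) = ev u * ev v.
  rewrite quadME /ev /= !(hornerD (_ * _) (_ * _)) !hornerM horner_cubic -onC; ring.
have evD u v : ev (u + v) = ev u + ev v.
  rewrite /ev (_ : u + v = (u.1 + v.1, u.2 + v.2)) // !hornerD; ring.
have [e dE eW] : exists2 e, d = c * e & ev e = 0.
  have : span ([set c] ** pt_gens (Some (x, y))) d by apply: sup.
  elim=> [_ [_ -> [s hs <-]]||u v _ [e -> he] _ [f -> hf]|k u _ [e -> he]].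
  - exists s => //; case: hs => ->; rewrite /ev /= !hornerE; ring.
  - by exists 0; rewrite ?mulr0 // /ev !hornerE.
  - by exists (e + f); rewrite ?mulrDr // evD he hf addr0.
  - by exists (k * e); rewrite ?evM ?he ?mulr0 // mulrCA.
have fac s : pt_gens (Some (x, y)) s -> exists r, s = e * r.
  move=> hs; have /span_set1[r rE] : span [set d] (c * s) by apply: sub; exists c => //; exists s.
  by exists r; apply: (quad_mulI size_cubic c0); rewrite rE dE mulrCA (mulrC r).
have [r rE] : exists r, xgen x = e * r by apply: fac; left.
have [r' r'E] : exists r, ygen y%:P = e * r by apply: fac; right.
have nX : quad_norm e * quad_norm r = ('X - x%:P) ^+ 2.
  by rewrite -quad_normM -rE /quad_norm /= expr0n mulr0 subr0.
have nr0 : quad_norm r != 0.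
  by apply: contraTneq (expf_neq0 2 (monic_neq0 (monicXsubC x))) => r0; rewrite -nX r0 mulr0 eqxx.
have ne0 : quad_norm e != 0.
  by apply: contraTneq (expf_neq0 2 (monic_neq0 (monicXsubC x))) => e0; rewrite -nX e0 mul0r eqxx.
have := congr1 (fun p : {poly K} => size p) nX.
rewrite /= size_exp_XsubC size_mul //.
have := @size_quad_norm_neq2 _ _ size_cubic e; have := @size_quad_norm_neq2 _ _ size_cubic r.
move: nr0 ne0; rewrite -!size_poly_gt0 => nr0 ne0 nr2 ne2 nn.
have [/(size_quad_norm1 size_cubic)[k k0 eE]|/(size_quad_norm1 size_cubic)[k k0 rE2]] :
    size (quad_norm e) = 1%N \/ size (quad_norm r) = 1%N.
  move: nr0 ne0 nr2 ne2 nn; move: (size _) (size _) => i j; lia.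
  by move: eW; rewrite eE /ev /= hornerC horner0 mul0r addr0; apply/eqP.
have e2 : e.2 = 0.
  move: rE; rewrite rE2 quadME /= !mulr0 add0r => /(congr1 snd) /= /esym/eqP.
  by rewrite mulf_eq0 polyC_eq0 (negPf k0) orbF => /eqP.
have e1 : e.1.[x] = 0 by move: eW; rewrite /ev e2 horner0 mul0r addr0.
move: r'E; rewrite quadME /= => /(congr1 snd) /= /(congr1 (fun p => p.[x])).
by rewrite e2 mul0r addr0 hornerM e1 mul0r hornerC => /eqP; rewrite oner_eq0.
Qed.

End PointClass.

(** * The group law *)

Section CurveGroup.
Variables (K : fieldType) (E : int * int).
Local Notation a := (E.1%:~R : K).
Local Notation b := (E.2%:~R : K).

(** The factor 2 excludes characteristic 2, where the denominators 2y of the tangent formulas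
    vanish. *)
Definition nonsingular : bool := 2 * (4 * a ^+ 3 + 27 * b ^+ 2) != 0 :> K.

Hypothesis nonsing : nonsingular.

Local Notation gens := (@pt_gens K a b).
Local Infix "**" := setM (at level 40, left associativity).
Local Infix "~~~" := same_class (at level 70).

Let mul_neq0 := @quad_mul_neq0 K (cubic a b) (size_cubic a b).
Let cls_trans := same_class_trans mul_neq0.

Lemma opp_on_curve (P : ecpoint K) : on_curve E P -> on_curve E (opp_pt P).
Proof. by case: P => [[x y]|] //=; rewrite sqrrN. Qed.

Lemma add_ptP (P Q : ecpoint K) : on_curve E P -> on_curve E Q ->
  on_curve E (add_pt E P Q) /\ gens P ** gens Q ~~~ gens (add_pt E P Q).
Proof.
case: P => [[x1 y1]|]; last first.
  by move=> _ /= HQ; split=> //; rewrite setMC setM1; exact/same_span_class/same_span_refl.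
case: Q => [[x2 y2]|]; last first.
  by move=> /= HP _; split=> //; rewrite setM1; exact/same_span_class/same_span_refl.
move=> C1 C2; rewrite /add_pt; case: ifP => [/andP[/eqP <- /eqP y12]|opp].
  split=> //; have -> : y2 = - y1 by rewrite y12 opprK.
  exact: opp_class.
set m := (if x1 == x2 then _ else _).
have sl : slope_of a x1 y1 x2 y2 m.
  rewrite /slope_of /m; case: (eqVneq x1 x2) => [x12|x12]; last first.
    by rewrite divfK // subr_eq0 eq_sym.
  move: opp; rewrite x12 eqxx /= => /negbT y12.
  have : y1 ^+ 2 == y2 ^+ 2 by rewrite /= in C1 C2; rewrite C1 C2 x12.
  rewrite eqf_sqr => /orP[/eqP y1E|/eqP y1E]; last by rewrite y1E eqxx in y12.
  have y10 : y1 != 0 by apply: contraNneq y12 => y0; rewrite -y1E y0 oppr0.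
  have t0 : 2 != 0 :> K by exact: two_neq0 nonsing.
  split=> //; field.
  by rewrite t0 y10.
split; last exact: chord_class.
have := congr1 (fun p => p.[m ^+ 2 - x1 - x2]) (line_cubic sl C1 C2).
rewrite /= [RHS]hornerM !hornerXsubC subrr mulr0 hornerD horner_cubic hornerN horner_exp.
rewrite hornerD hornerM !hornerC hornerX => /eqP; rewrite subr_eq0 => /eqP ->.
ring.
Qed.

(** Multiplying by the class of -Q shows that P + (-Q) has trivial class, so it is the point at
    infinity; the addition formula returns infinity only on opposite points. *)
Lemma gens_inj (P Q : ecpoint K) : on_curve E P -> on_curve E Q ->
  gens P ~~~ gens Q -> P = Q.
Proof.
move=> CP CQ PQ; have CQ' := opp_on_curve CQ.
have [CR] := add_ptP CP CQ'; have [_] := add_ptP CQ CQ'.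
have -> : add_pt E Q (opp_pt Q) = None.
  by case: (Q) => [[x y]|] //=; rewrite eqxx opprK eqxx.
move=> QQ PQ'; have := cls_trans (same_class_sym PQ') (cls_trans (same_classM _ PQ) QQ).
case RE: (add_pt E P (opp_pt Q)) CR => [[x y]|] CR.
  by move/(affine_not_principal nonsing CR).
move=> _; move: RE; case: (P) (Q) => [[x1 y1]|] [[x2 y2]|] //=.
by case: ifP => // /andP[/eqP -> /eqP ->]; rewrite opprK.
Qed.

Definition on_curveb (P : option (K * K)) : bool :=
  if P is Some (x, y) then y ^+ 2 == x ^+ 3 + a * x + b else true.

Lemma on_curveP (P : ecpoint K) : reflect (on_curve E P) (on_curveb P).
Proof. by case: P => [[x y]|]; [apply: eqP | left]. Qed.

(** The proof is a parameter of the type so that the group structure, which depends on it, can be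
    attached as an instance. *)
Definition ec (_ : nonsingular) : Type := {P : option (K * K) | on_curveb P}.

Local Notation G := (ec nonsing).
HB.instance Definition _ := Choice.copy G {P : option (K * K) | on_curveb P}.

Definition ec_pt (P : G) : ecpoint K := sval P.

Lemma ec_pt_inj : injective ec_pt. Proof. exact: val_inj. Qed.

Lemma ec_on_curve (P : G) : on_curve E (ec_pt P).
Proof. exact/on_curveP/(valP P). Qed.

Definition Ec (P : ecpoint K) (h : on_curve E P) : G := exist _ P (introT (on_curveP P) h).

Definition ec_add (P Q : G) : G := Ec (proj1 (add_ptP (ec_on_curve P) (ec_on_curve Q))).
Definition ec_opp (P : G) : G := Ec (opp_on_curve (ec_on_curve P)).
Definition ec_zero : G := @Ec None I.

Fact ec_addA : associative ec_add.
Proof.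
move=> P Q R; apply: ec_pt_inj => /=.
set p := ec_pt P; set q := ec_pt Q; set r := ec_pt R.
have [Cp Cq Cr] : [/\ on_curve E p, on_curve E q & on_curve E r].
  by split; apply: ec_on_curve.
have [Cpq pq] := add_ptP Cp Cq; have [Cqr qr] := add_ptP Cq Cr.
have [C1 h1] := add_ptP Cp Cqr; have [C2 h2] := add_ptP Cpq Cr.
apply: gens_inj => //; apply: cls_trans (same_class_sym h1) _; apply: cls_trans h2.
apply: cls_trans (same_classM _ pq); rewrite -setMA setMC [X in _ ~~~ X]setMC.
exact: (same_classM _ (same_class_sym qr)).
Qed.

Fact ec_addC : commutative ec_add.
Proof.
move=> P Q; apply: ec_pt_inj => /=.
have [C1 h1] := add_ptP (ec_on_curve P) (ec_on_curve Q).
have [C2 h2] := add_ptP (ec_on_curve Q) (ec_on_curve P).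
by apply: gens_inj => //; apply: cls_trans (same_class_sym h1) _; rewrite setMC.
Qed.

Fact ec_add0 : left_id ec_zero ec_add.
Proof. by move=> P; apply: ec_pt_inj. Qed.

Fact ec_addN : left_inverse ec_zero ec_opp ec_add.
Proof.
move=> P; apply: ec_pt_inj; rewrite /ec_add /ec_opp /= /ec_pt /=.
by case: (sval P) => [[x y]|] //=; rewrite !eqxx.
Qed.

HB.instance Definition _ := GRing.isZmodule.Build G ec_addA ec_addC ec_add0 ec_addN.

Lemma ec_ptD (P Q : G) : ec_pt (P + Q) = add_pt E (ec_pt P) (ec_pt Q).
Proof. by []. Qed.

Lemma ec_ptN (P : G) : ec_pt (- P) = opp_pt (ec_pt P).
Proof. by []. Qed.

Lemma ec_pt0 : ec_pt 0 = None. Proof. by []. Qed.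

Lemma ec_ptMn (P : G) n : ec_pt (P *+ n) = iter n (add_pt E (ec_pt P)) None.
Proof. by elim: n => [|n IH] //; rewrite mulrS ec_ptD IH. Qed.

Lemma ec_ptMz (P : G) m : ec_pt (P *~ m) = mul_pt E m (ec_pt P).
Proof. by case: m => n; rewrite /mul_pt -ec_ptMn. Qed.

End CurveGroup.

(** * Action of field morphisms on points *)

Section Functoriality.
Variables (K L : fieldType) (E : int * int) (f : {rmorphism K -> L}).
Implicit Types P Q : ecpoint K.

Lemma map_on_curve P : on_curve E P -> on_curve E (map_pt f P).
Proof.
by case: P => [[x y]|] //= C; rewrite -!(rmorphXn f) C !rmorphD (rmorphM f E.1%:~R) !rmorph_int.
Qed.

Lemma map_opp_pt P : map_pt f (opp_pt P) = opp_pt (map_pt f P).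
Proof. by case: P => [[x y]|] //=; rewrite rmorphN. Qed.

Lemma map_add_pt P Q : map_pt f (add_pt E P Q) = add_pt E (map_pt f P) (map_pt f Q).
Proof.
case: P Q => [[x1 y1]|] [[x2 y2]|] //=; rewrite -(rmorphN f) !(fmorph_eq f).
case: ifP => // _; case: ifP => _ /=;
  by rewrite !(rmorph_nat, rmorph_int, rmorphB, rmorphD, rmorphXn, rmorphM, fmorphV) //=.
Qed.

Variables (hK : nonsingular K E) (hL : nonsingular L E).

Definition ec_map (P : ec hK) : ec hL := Ec hL (map_on_curve (ec_on_curve P)).

Fact ec_map_is_additive : zmod_morphism ec_map.
Proof.
move=> P Q; apply: ec_pt_inj; rewrite ec_ptD ec_ptN.
by rewrite -[RHS]/(add_pt E (map_pt f (ec_pt P)) (opp_pt (map_pt f (ec_pt Q))))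
  -map_opp_pt -map_add_pt.
Qed.

HB.instance Definition _ := GRing.isZmodMorphism.Build (ec hK) (ec hL) ec_map ec_map_is_additive.

Lemma ec_mapMn (P : ec hK) n : ec_map (P *+ n) = ec_map P *+ n.
Proof. exact: raddfMn. Qed.

Lemma ec_mapB (P Q : ec hK) : ec_map (P - Q) = ec_map P - ec_map Q.
Proof. exact: raddfB. Qed.

Lemma ec_mapD (P Q : ec hK) : ec_map (P + Q) = ec_map P + ec_map Q.
Proof. exact: raddfD. Qed.

Lemma ec_map_pt (P : ec hK) : ec_pt (ec_map P) = map_pt f (ec_pt P).
Proof. by []. Qed.

Lemma ec_map_inj : injective ec_map.
Proof.
move=> P Q /(congr1 (@ec_pt _ _ _)); rewrite !ec_map_pt => PQ; apply: ec_pt_inj; move: PQ.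
by case: (ec_pt P) (ec_pt Q) => [[x y]|] [[x' y']|] //= [/fmorph_inj-> /fmorph_inj->].
Qed.

End Functoriality.

(** * Multiplication by n is surjective over an algebraically closed field *)

Section Abscissa.
Variables (K : fieldType) (E : int * int) (h : nonsingular K E).
Local Notation G := (ec h).
Local Notation a := (E.1%:~R : K).
Local Notation b := (E.2%:~R : K).
Local Notation W := (cubic a b).

(** The 0 at infinity is a default value; abscissae are only compared between nonzero points. *)
Definition abscissa (P : G) : K := if ec_pt P is Some (x, _) then x else 0.

Lemma ec_pt_neq0 (P : G) : P != 0 -> exists2 y, ec_pt P = Some (abscissa P, y) &
  y ^+ 2 = W.[abscissa P].
Proof.
move=> P0; have := ec_on_curve P; rewrite /abscissa.
case PE: (ec_pt P) => [[x y]|] /=; first by exists y; rewrite ?horner_cubic.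
by case/eqP: P0; apply: ec_pt_inj.
Qed.

Lemma abscissa_inj (P Q : G) : P != 0 -> Q != 0 -> abscissa P = abscissa Q ->
  P = Q \/ P = - Q.
Proof.
move=> /ec_pt_neq0[y PE yW] /ec_pt_neq0[z QE zW] PQ.
have : y ^+ 2 == z ^+ 2 by rewrite yW zW PQ.
rewrite eqf_sqr => /orP[]/eqP yz; [left|right]; apply: ec_pt_inj.
  by rewrite PE QE PQ yz.
by rewrite ec_ptN PE QE PQ yz.
Qed.

Lemma poly_nonroot (p : {poly K}) (f : nat -> K) : p != 0 -> injective f ->
  exists k, p.[f k] != 0.
Proof.
move=> p0 finj; apply/not_existsP => H.
have := @max_poly_roots _ p [seq f k | k <- iota 0 (size p)] p0.
rewrite map_inj_uniq ?iota_uniq // size_map size_iota ltnn => /(_ _ isT) C.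
suff: false by []. apply: C; apply/allP => _ /mapP[k _ ->].
by apply/negPn/negP; apply: H.
Qed.

Section InfiniteOrder.
Variable P1 : G.
Hypothesis P1inf : forall n, (0 < n)%N -> P1 *+ n != 0.

Lemma mulrn_inj_inf : injective (GRing.natmul P1).
Proof.
have le k l : (k <= l)%N -> P1 *+ k = P1 *+ l -> k = l.
  move=> kl; rewrite -{1}(subnKC kl) mulrnDr => /eqP.
  rewrite -[X in X == _]addr0 (inj_eq (addrI _)) eq_sym => /eqP H.
  apply/eqP; rewrite eqn_leq kl /= -subn_eq0 -leqn0 leqNgt.
  by apply/negP => /P1inf; rewrite H eqxx.
by move=> k l kl; case: (leqP k l) => [/le|/ltnW/le] /(_ (esym _)) //; [|move->]; auto.
Qed.

Lemma abscissa_mul_inj : injective (fun k => abscissa (P1 *+ k.+1)).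
Proof.
move=> k l kl; have [] := abscissa_inj (P1inf _) (P1inf _) kl => //.
  by move/mulrn_inj_inf => [].
by move/eqP; rewrite -addr_eq0 -mulrnDr (negPf (P1inf _)).
Qed.

(* Multiplication by n > 0 is (x, y) |-> (A(x) / D(x), y C(x) / D(x)) away
   from finitely many points.  The chord formula for n.+1 = 1 + n applies
   unless n = 1, or n acts as +1 or -1, which is ruled out by the point of
   infinite order. *)
Lemma mul_rational n : (0 < n)%N -> exists A C D : {poly K}, D != 0 /\
  forall (P : G) x y, ec_pt P = Some (x, y) -> D.[x] != 0 ->
    ec_pt (P *+ n) = Some (A.[x] / D.[x], y * (C.[x] / D.[x])).
Proof.
case: n => // -[_|n _].
  exists 'X, 1, 1; split=> [|P x y PE _]; first exact: oner_neq0.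
  by rewrite mulr1n PE hornerX -polyC1 !hornerC !divr1 mulr1.
have t0 : 2 != 0 :> K by exact: two_neq0 h.
have [W [W0 WE]] : exists W : {poly K}, W != 0 /\ forall x, W.[x] = x ^+ 3 + a * x + b.
  by exists W; rewrite -size_poly_eq0 size_cubic; split=> // x; rewrite horner_cubic.
have onW (P : G) x y : ec_pt P = Some (x, y) -> y ^+ 2 = W.[x].
  by move=> PE; have := ec_on_curve P; rewrite PE WE.
pose horner_simp := (horner_exp, hornerD, hornerN, hornerM, hornerC, hornerX).
have t8 : 8 != 0 :> K by rewrite (_ : 8 = 2 ^+ 3) ?expf_neq0 //; ring.
elim: n => [|n [A [C [D [D0 IH]]]]].
  (* The tangent formulas with y^2 replaced by W, over the common denominator 8 W^2. *)
  pose N : {poly K} := 3%:P * 'X ^+ 2 + a%:P.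
  exists ((N ^+ 2 - 8%:P * 'X * W) * (2%:P * W)), (N * (12%:P * 'X * W - N ^+ 2) - 8%:P * W ^+ 2),
    (8%:P * W ^+ 2).
  split.
    by rewrite mulf_neq0 ?expf_neq0 // polyC_eq0.
  move=> P x y PE; rewrite /N !horner_simp => D0.
  have Wx0 : W.[x] != 0 by apply: contraNneq D0 => ->; rewrite expr0n mulr0.
  have yW := onW _ _ _ PE.
  have y0 : y != 0 by apply: contraNneq Wx0 => y0; rewrite -yW y0 expr0n.
  have yNy : (y == - y) = false.
    by rewrite -addr_eq0 -mulr2n -mulr_natl mulf_eq0 (negPf t0) (negPf y0).
  rewrite mulrS mulr1n ec_ptD PE /= eqxx yNy /=.
  by rewrite -yW; congr (Some (_, _)); field; rewrite y0 t0 ?t8.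
(* If A = X D identically, the (n+2)-fold multiple of a suitable multiple P of P1 has the abscissa
   of P, so it is P or -P and P is torsion. *)
have [AX|AX] := eqVneq A ('X * D).
  have [k Dk] := poly_nonroot D0 abscissa_mul_inj.
  have [y PE yW] := ec_pt_neq0 (P1inf (ltn0Sn k)).
  set P := P1 *+ k.+1 in PE yW Dk; have nPE := IH _ _ _ PE Dk.
  have nP0 : P *+ n.+2 != 0 by apply/eqP => nP0; rewrite nP0 in nPE.
  have : abscissa (P *+ n.+2) = abscissa P.
    by rewrite {1}/abscissa nPE AX hornerM hornerX mulfK.
  case/abscissa_inj => //; rewrite ?P1inf //.
    rewrite mulrS => /eqP; rewrite -[X in _ == X]addr0 (inj_eq (addrI _)).
    by rewrite -mulrnA (negPf (P1inf _)).
  by move/eqP; rewrite -addr_eq0 -mulrSr -mulrnA (negPf (P1inf _)).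
(* The chord through P and its multiple has slope y (C - D) / e, and the new abscissa is N / (e^2
   D). *)
pose e := A - 'X * D; have e0 : e != 0 by rewrite subr_eq0.
pose N := W * (C - D) ^+ 2 * D - (A + 'X * D) * e ^+ 2.
exists (N * e), ((C - D) * ('X * e ^+ 2 * D - N) - e ^+ 3 * D), (e ^+ 3 * D).
split; first by rewrite mulf_neq0 ?expf_neq0.
move=> P x y PE; rewrite hornerM horner_exp mulf_eq0 expf_eq0 negb_or => /andP[ex0' Dx0].
have {ex0'}ex0 : e.[x] != 0 by [].
rewrite mulrS ec_ptD (IH _ _ _ PE Dx0) PE /=; have yW := onW _ _ _ PE.
have eE : e.[x] = A.[x] - x * D.[x] by rewrite /e !horner_simp.
rewrite eE in ex0.
have -> : (x == A.[x] / D.[x]) = false.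
  apply/negbTE; apply: contraNneq ex0 => xE; by rewrite subr_eq0 -{1}(divfK Dx0 A.[x]) -xE.
rewrite /= /N /e !horner_simp -yW.
by congr (Some (_, _)); field; rewrite Dx0 ex0.
Qed.

Lemma poly_mul_abscissa (p : {poly K}) : p != 0 ->
  exists2 k, (0 < k)%N & p.[abscissa (P1 *+ k)] != 0.
Proof. by move=> /poly_nonroot /(_ abscissa_mul_inj)[k pk]; exists k.+1. Qed.

End InfiniteOrder.
End Abscissa.

Section Divisibility.
Variables (K : closedFieldType) (E : int * int) (h : nonsingular K E).
Local Notation G := (ec h).
Local Notation a := (E.1%:~R : K).
Local Notation b := (E.2%:~R : K).

Lemma sqrt_exists (w : K) : exists y, y ^+ 2 = w.
Proof.
have [y yE] := @solve_monicpoly K 2 (fun i => if i is 0 then w else 0) isT.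
by exists y; rewrite yE !big_ord_recl big_ord0 /= mulr1 mul0r !addr0.
Qed.

Lemma abscissa_surj (x : K) : exists y, exists P : G, ec_pt P = Some (x, y).
Proof.
have [y yE] := sqrt_exists (x ^+ 3 + a * x + b).
have C : on_curve E (Some (x, y)) by [].
by exists y, (Ec h C).
Qed.

Variable P1 : G.
Hypothesis P1inf : forall n, (0 < n)%N -> P1 *+ n != 0.

(** With A' / D' the reduced form of A / D, a root x of A' - u D' gives a point whose n-fold
    multiple is U or -U. B discards the u for which this polynomial is constant or shares a root
    with D. *)
Lemma mul_cofinite n : (0 < n)%N -> exists2 B : {poly K}, B != 0 &
  forall U : G, U != 0 -> B.[abscissa U] != 0 -> exists Q, Q *+ n = U.
Proof.
move=> n0; have [A [C [D [D0 nE]]]] := mul_rational P1inf n0.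
pose g := gcdp A D; pose A' : {poly K} := A %/ g; pose D' : {poly K} := D %/ g.
have AE : A = A' * g by rewrite divpK ?dvdp_gcdl.
have DE : D = D' * g by rewrite divpK ?dvdp_gcdr.
have cop : coprimep A' D' by rewrite coprimep_div_gcd // D0 orbT.
have D'0 : D' != 0 by apply: contraNneq D0 => z; rewrite DE z mul0r.
(* Otherwise n k P1 and n l P1 would have the same abscissa for some k and l with distinct abscissae
   of k P1 and l P1. *)
have nonconst : ~ (size A' <= 1 /\ size D' <= 1)%N.
  move=> [/size1_polyC A'c /size1_polyC D'c].
  have xn (P : G) x z : ec_pt P = Some (x, z) -> D.[x] != 0 ->
      P *+ n != 0 /\ abscissa (P *+ n) = A'`_0 / D'`_0.
    move=> PE Dx; have nPE := nE _ _ _ PE Dx; split.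
      by apply/eqP => nP0; rewrite nP0 in nPE.
    rewrite /abscissa nPE; have gx : g.[x] != 0.
      by move: Dx; rewrite DE hornerM mulf_eq0 negb_or => /andP[].
    by rewrite {1}AE {1}DE A'c D'c !hornerM !hornerC -mulf_div divff // mulr1 !coefC.
  have [k k0 Dk] := poly_mul_abscissa P1inf D0.
  have /(poly_mul_abscissa P1inf)[l l0] : D * ('X - (abscissa (P1 *+ k))%:P) != 0.
    by rewrite mulf_neq0 // polyXsubC_eq0.
  rewrite hornerM mulf_eq0 negb_or hornerXsubC subr_eq0 => /andP[Dl kl].
  have [y kE _] := ec_pt_neq0 (P1inf k0); have [z lE _] := ec_pt_neq0 (P1inf l0).
  have [nk xk] := xn _ _ _ kE Dk; have [nl xl] := xn _ _ _ lE Dl.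
  have := abscissa_inj nk nl; rewrite xk xl -!mulrnA => /(_ erefl)[].
    move/(mulrn_inj_inf P1inf) => /eqP; rewrite eqn_pmul2r // => /eqP klE.
    by rewrite klE eqxx in kl.
  by move/eqP; rewrite -addr_eq0 -mulrnDr (negPf (P1inf _)) // addn_gt0 muln_gt0 k0 n0.
have [r rE] := closed_field_poly_normal D.
(* No factor is zero because A' and D' are coprime. *)
pose B1 := \prod_(x <- r) (A'.[x]%:P - D'.[x]%:P * 'X).
have B10 : B1 != 0.
  rewrite prodf_seq_neq0; apply/allP => x _ /=; apply/eqP => F0.
  have A'x : root A' x.
    by have := congr1 (horner^~ 0) F0; rewrite /root /= hornerD hornerN hornerM !hornerC hornerX
      mulr0 subr0 => ->.
  have := congr1 (horner^~ 1) F0; rewrite /= hornerD hornerN hornerM !hornerC hornerX mulr1.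
  by rewrite (rootP A'x) sub0r => /eqP; rewrite oppr_eq0 (negPf (coprimep_root cop A'x)).
(* At most one u is exceptional: two of them would make D', and then A', constant. *)
have [B2 B20 B2P] : exists2 B2 : {poly K}, B2 != 0 &
    forall u, B2.[u] != 0 -> (1 < size (A' - u%:P * D')%R)%N.
  have [[u0 cu0]|none] := pselect (exists u0, (size (A' - u0%:P * D')%R <= 1)%N); last first.
    exists 1; rewrite ?oner_neq0 // => u _; rewrite ltnNge; apply/negP => ?.
    by apply: none; exists u.
  exists ('X - u0%:P); first by rewrite polyXsubC_eq0.
  move=> u; rewrite hornerXsubC subr_eq0 => uu0; rewrite ltnNge; apply/negP => cu.
  have D'c : (size D' <= 1)%N.
    have uu : u - u0 != 0 by rewrite subr_eq0.
    have -> : D' = (u - u0)^-1%:P * ((A' - u0%:P * D') - (A' - u%:P * D')).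
      have -> : (A' - u0%:P * D') - (A' - u%:P * D') = (u - u0)%:P * D' by rewrite polyCB; ring.
      by rewrite mulrA -polyCM mulVf // mul1r.
    rewrite mul_polyC (leq_trans (size_scale_leq _ _)) // (leq_trans (size_polyD _ _)) //.
    by rewrite size_polyN geq_max cu0 cu.
  apply: nonconst; split=> //; have -> : A' = (A' - u%:P * D') + u *: D'.
    by rewrite -mul_polyC subrK.
  rewrite (leq_trans (size_polyD _ _)) // geq_max cu /=.
  exact: leq_trans (size_scale_leq _ _) _.
exists (B1 * B2); first by rewrite mulf_neq0.
move=> U U0; rewrite hornerM mulf_eq0 negb_or => /andP[B1U B2U].
set u := abscissa U in B1U B2U.
have /closed_rootP[x] : size (A' - u%:P * D') != 1%N by rewrite gtn_eqF // B2P.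
rewrite /root hornerD hornerN hornerM hornerC subr_eq0 => /eqP xE.
have Dx : D.[x] != 0.
  apply: contraNneq B1U => Dx; rewrite /B1 horner_prod prodf_seq_eq0; apply/hasP; exists x => /=.
    move/rootP: Dx; rewrite {1}rE rootZ ?lead_coef_eq0 //.
    by rewrite root_prod_XsubC.
  by rewrite !(hornerD, hornerN, hornerM, hornerC, hornerX) xE mulrC subrr.
have [y [Q QE]] := abscissa_surj x.
have nQE := nE _ _ _ QE Dx.
have nQ0 : Q *+ n != 0 by apply/eqP => nQ0; rewrite nQ0 in nQE.
have : abscissa (Q *+ n) = u.
  rewrite /abscissa nQE.
  move: (Dx); rewrite DE hornerM mulf_eq0 negb_or => /andP[D'x gx].
  by rewrite {1}AE !hornerM -mulf_div divff // mulr1 xE mulfK.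
case/(abscissa_inj nQ0 U0) => QU; first by exists Q.
by exists (- Q); rewrite mulNrn QU opprK.
Qed.

(** The translates of P by multiples of nP1 have infinitely many abscissae, so one of them avoids
    the roots of B and is divisible by n; the translation is itself divisible. *)
Lemma ec_divisible n (P : G) : (0 < n)%N -> exists Q, Q *+ n = P.
Proof.
move=> n0; have [B B0 BP] := mul_cofinite n0.
(* Multiples beyond t keep the translates nonzero and prevent two of them from being opposite, which
   would make 2P a multiple of P1. *)
have [t tP] : exists t, forall k, (t < k)%N -> P *+ 2 != P1 *+ k.
  have [[t tE]|none] := pselect (exists t, P *+ 2 = P1 *+ t); last first.
    by exists 0 => k _; apply/eqP => ?; apply: none; exists k.
  by exists t => k tk; rewrite tE (inj_eq (mulrn_inj_inf P1inf)) neq_ltn tk.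
pose m k := ((t + k).+1 * n)%N.
have tm k : (t < m k)%N by rewrite /m; nia.
have PN0 k : P - P1 *+ m k != 0.
  rewrite subr_eq0; apply/eqP => PE; have := tP (m k * 2)%N; rewrite PE -mulrnA eqxx.
  by move=> F; suff: false by []; apply: F; have := tm k; lia.
have finj : injective (fun k => abscissa (P - P1 *+ m k)).
  move=> k l /(abscissa_inj (PN0 k) (PN0 l))[].
    move/addrI/oppr_inj/(mulrn_inj_inf P1inf); rewrite /m => /eqP.
    by rewrite eqn_pmul2r // eqSS eqn_add2l => /eqP.
  move/eqP; rewrite opprB -subr_eq0 opprB => H; have := tP (m k + m l)%N.
  have -> : P *+ 2 = P1 *+ (m k + m l).
    apply/eqP; rewrite -subr_eq0 mulrnDr mulr2n -(eqP H); apply/eqP.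
    by rewrite opprD addrACA.
  by rewrite eqxx => F; suff: false by []; apply: F; have := tm k; lia.
have [k Bk] := poly_nonroot B0 finj.
have [Q QE] := BP _ (PN0 k) Bk.
exists (Q + P1 *+ (t + k).+1).
by rewrite mulrnDl QE -mulrnA subrK.
Qed.

End Divisibility.

(** * The Kummer map *)

(** The splitting field of the minimal polynomial of x is Galois over Q, and each of its
    automorphisms extends to [algC]; so x lies in the fixed field, which is Q. *)
Lemma fixed_by_galQ (x : algC) : (forall s : {rmorphism algC -> algC}, s x = x) ->
  exists q : rat, x = ratr q.
Proof.
move=> fixx; have [p [pE mon_p] pP] := minCpolyP x.
have [r rE] := closed_field_poly_normal (map_poly ratr p : {poly algC}).
rewrite lead_coef_map (monicP mon_p) rmorph1 scale1r in rE.
have [Qr [QrC [rr rrE genQr]]] := num_field_exists r.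
have inj_poly q : map_poly QrC (map_poly (in_alg Qr) q) = map_poly ratr q.
  by rewrite -map_poly_comp; apply: eq_map_poly => a; rewrite /= rmorphZ_num rmorph1 mulr1.
have splitQr : splittingFieldFor 1 (map_poly (in_alg Qr) p) fullv.
  exists rr => //; congr (_ %= _): (eqpxx (map_poly (in_alg Qr) p)).
  apply/(map_poly_inj QrC); rewrite inj_poly rE -rrE big_map rmorph_prod /=.
  by apply: eq_bigr => z _; rewrite map_polyXsubC.
have pOver : map_poly (in_alg Qr) p \is a polyOver 1%VS.
  by apply/polyOverP=> i; rewrite coef_map memvZ ?memv_line.
have ax : splitting_field_axiom Qr by exists (map_poly (in_alg Qr) p).
pose Qn : splittingFieldType rat := HB.pack Qr (FieldExt_isSplittingField.Build rat Qr ax).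
have rx : x \in r.
  by rewrite -root_prod_XsubC -rE -pE root_minCpoly.
have [xx xxE] : exists xx : Qn, QrC xx = x.
  by move: rx; rewrite -rrE => /mapP[xx _ ->]; exists xx.
have galQn : galois 1 {: Qn}.
  rewrite /galois sub1v normalFieldf andbT /=; apply/separableP => y _.
  by apply: pcharf0_separable => q; rewrite pchar_lalg pchar_num.
have /galois_fixedField fixQ := galQn.
have : xx \in fixedField 'Gal({: Qn} / 1)%g.
  apply/fixedFieldP; first exact: memvf.
  move=> g _; apply: (fmorph_inj QrC).
  have [nu nuE] := extend_algC_subfield_aut QrC (gal_repr g : {rmorphism Qr -> Qr}).
  by rewrite nuE xxE fixx.
rewrite fixQ => /vlineP[q qE]; exists q.
by rewrite -xxE qE rmorphZ_num rmorph1 mulr1.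
Qed.

Lemma elliptic_nonsingular (K : numFieldType) E : elliptic E -> nonsingular K E.
Proof.
move=> [d0 _]; rewrite /nonsingular mulf_neq0 ?pnatr_eq0 //.
by move: d0; rewrite -(intr_eq0 K) rmorphD (rmorphM _ 4) (rmorphM _ 27) !rmorphXn.
Qed.

Section Kummer.
Variables (E : int * int) (hQ : nonsingular rat E) (h : nonsingular algC E).
Variables (R : realType) (n : nat).
Hypothesis n_gt0 : (0 < n)%N.
Local Notation act s := (@ec_map algC algC E s h h).

Definition rat_point : ec hQ -> ec h := @ec_map rat algC E ratr hQ h.

Lemma act_rat_point (s : {rmorphism algC -> algC}) P : act s (rat_point P) = rat_point P.
Proof.
apply: ec_pt_inj; rewrite !ec_map_pt.
by case: (ec_pt P) => [[x y]|] //=; rewrite !fmorph_rat.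
Qed.

Lemma act_comp (s t : {rmorphism algC -> algC}) T : act (s \o t) T = act s (act t T).
Proof. by apply: ec_pt_inj; rewrite !ec_map_pt; case: (ec_pt T) => [[x y]|]. Qed.

Lemma act_fixed (T : ec h) : (forall s, act s T = T) -> exists S, T = rat_point S.
Proof.
move=> fixT; case TE: (ec_pt T) => [[x y]|]; last first.
  by exists 0; apply: ec_pt_inj; rewrite TE.
have fixxy (s : {rmorphism algC -> algC}) : s x = x /\ s y = y.
  by have := congr1 (@ec_pt _ _ _) (fixT s); rewrite ec_map_pt TE /= => -[-> ->].
have [p xp] := fixed_by_galQ (fun s => (fixxy s).1).
have [q yq] := fixed_by_galQ (fun s => (fixxy s).2).
have C : on_curve E (Some (p, q)).
  have := ec_on_curve T; rewrite TE xp yq /=.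
  rewrite -!rmorphXn -(rmorph_int (ratr : rat -> algC) E.1) -(rmorph_int (ratr : rat -> algC) E.2).
  by rewrite -rmorphM -!rmorphD => /fmorph_inj.
by exists (Ec hQ C); apply: ec_pt_inj; rewrite TE ec_map_pt xp yq.
Qed.

Definition kummer_cocycle (Q : ec h) (s : {rmorphism algC -> algC}) : ecpoint algC :=
  ec_pt (act s Q - Q).

Lemma kummer_torsion (Q : ec h) P s : Q *+ n = rat_point P ->
  torsion_pt E n (kummer_cocycle Q s).
Proof.
move=> QP; split; first exact: ec_on_curve.
by rewrite -ec_ptMz -pmulrn mulrnBl -ec_mapMn QP act_rat_point subrr.
Qed.

Lemma kummer_cocycleP (Q : ec h) P : Q *+ n = rat_point P ->
  cocycle E n (kummer_cocycle Q).
Proof.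
move=> QP; split; first by move=> s; apply: kummer_torsion QP.
- move=> s t; rewrite /kummer_cocycle -ec_map_pt -ec_ptD act_comp ec_mapB.
  by rewrite addrCA addrAC subrr add0r.
(* The value at s depends only on what s does to the coordinates of Q. *)
- move=> s; exists (if ec_pt Q is Some (x, y) then [:: x; y] else [::]) => t st.
  congr ec_pt; congr (_ - _); apply: ec_pt_inj; rewrite !ec_map_pt.
  by case: (ec_pt Q) st => [[x y]|] //= st; rewrite !st // !inE eqxx ?orbT.
Qed.

(** The cocycle is the coboundary of Q in E(Qbar), so the image of Q trivialises it at every
    place. *)
Lemma kummer_locally_trivial (Q : ec h) : locally_trivial E R (kummer_cocycle Q).
Proof.
move=> w _ K v _ L i _ j; exists (map_pt j (ec_pt Q)).
  exact/map_on_curve/ec_on_curve.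
move=> s _ t st; rewrite /kummer_cocycle ec_ptD ec_ptN map_add_pt map_opp_pt ec_map_pt.
by congr add_pt; case: (ec_pt Q) => [[x y]|] //=; rewrite !st.
Qed.

(** If the cocycles differ by the coboundary of an n-torsion point T, then Q' - Q - T is Galois
    invariant, hence a rational point S, and its n-fold multiple is P' - P. *)
Lemma kummer_inj (Q Q' : ec h) P P' : Q *+ n = rat_point P -> Q' *+ n = rat_point P' ->
  cohomology_class E n (kummer_cocycle Q) = cohomology_class E n (kummer_cocycle Q') ->
  exists S, P' = P + S *+ n.
Proof.
move=> QP QP' cls.
have : cohomology_class E n (kummer_cocycle Q) (kummer_cocycle Q').
  rewrite cls; split; first exact: kummer_cocycleP QP'.
  exists None; last by move=> s; rewrite /=; case: (kummer_cocycle Q' s) => [[]|].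
  by split=> //; rewrite -(ec_pt0 h) -(ec_ptMz _ n%:Z) mul0rz.
move=> [_ [T0 [CT nT] H]]; pose T := Ec h CT.
have Tn : T *+ n = 0 by apply: ec_pt_inj; rewrite pmulrn ec_ptMz.
have [s|S SE] := @act_fixed (Q' - Q - T).
  have : act s Q' - Q' = (act s Q - Q) + (act s T - T).
    apply: ec_pt_inj; rewrite -[LHS]/(kummer_cocycle Q' s) H.
    by rewrite !ec_ptD !ec_ptN !ec_map_pt.
  rewrite !ec_mapB => /eqP; rewrite subr_eq => /eqP ->.
  rewrite -[LHS]addrA -opprD (addrACA (act s Q)) -opprD [LHS]addrAC.
  by rewrite (addrC (act s Q + act s T)) addrK addrC opprD addrA.
exists S; apply: (@ec_map_inj rat algC E ratr hQ h); rewrite ec_mapD ec_mapMn.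
rewrite -!/(rat_point _) -SE !mulrnBl QP QP' Tn subr0.
by rewrite addrC subrK.
Qed.

(** One rational point is chosen for every Selmer class, 0 if the class is not in the Kummer image.
    Thus E(Q)/nE(Q) need not be formed or known to be finite beforehand. *)
Lemma selmer_representatives (P1 : ec hQ) : (forall m, (0 < m)%N -> P1 *+ m != 0) ->
  finite_set (selmer E n R) ->
  exists2 r : seq (ec hQ), size r = #|` fset_set (selmer E n R)| &
    forall P, exists2 i, i \in r & exists S, P = i + S *+ n.
Proof.
move=> P1inf fin.
have Q1inf m : (0 < m)%N -> rat_point P1 *+ m != 0.
  move=> m0; rewrite -ec_mapMn; apply: contra (P1inf _ m0) => /eqP H; apply/eqP.
  by apply: (@ec_map_inj rat algC E ratr hQ h); rewrite raddf0.
have /choice[Q QE] : forall P : ec hQ, exists Q, Q *+ n = rat_point P.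
  by move=> P; exact: (ec_divisible Q1inf (rat_point P) n_gt0).
pose cls P := cohomology_class E n (kummer_cocycle (Q P)).
have /choice[g gE] : forall c, exists P, (exists P', cls P' = c) -> cls P = c.
  move=> c; have [[P PE]|none] := pselect (exists P', cls P' = c); first by exists P.
  by exists 0.
exists [seq g c | c <- fset_set (selmer E n R)]; first by rewrite size_map.
move=> P; exists (g (cls P)).
  apply: map_f; rewrite in_fset_set //; apply/mem_set; exists (kummer_cocycle (Q P)) => //.
  by split; [apply: kummer_cocycleP (QE P) | apply: kummer_locally_trivial].
by apply: kummer_inj (QE _) (QE _) _; apply: gE; exists P.
Qed.

End Kummer.

(** * Counting points of bounded height *)

Section HeightCounting.
Variables (R : realFieldType) (A : zmodType) (h : A -> R) (C : R).
Hypothesis C_ge0 : 0 <= C.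
Hypothesis h_ge0 : forall P, 0 <= h P.
Hypothesis h_finite : forall T, exists s : seq A, forall P, h P <= T -> P \in s.
Hypothesis h_par : forall P Q, h (P + Q) + h (P - Q) <= 2 * h P + 2 * h Q + C.
Hypothesis h_dup : forall P, 4 * h P - C <= h (P + P).

(** The upper inequality is applied to P + Q and P - Q, whose sum and difference are 2P and 2Q. *)
Lemma height_par_ge P Q : 2 * h P + 2 * h Q - 2 * C <= h (P + Q) + h (P - Q).
Proof.
have E1 : P + Q + (P - Q) = P + P by rewrite addrACA subrr addr0.
have E2 : P + Q - (P - Q) = Q + Q by rewrite opprB addrC addrA subrK.
have := h_par (P + Q) (P - Q); rewrite E1 E2.
have := h_dup P; have := h_dup Q; have := C_ge0; lra.
Qed.

(** Up to O(1) the parallelogram law is a recurrence in m of order two, solved by m^2 h(P); hence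
    the induction on two consecutive m. *)
Lemma height_mul m : exists c, forall P, `|h (P *+ m) - m%:R ^+ 2 * h P| <= c.
Proof.
suff [] : (exists c, forall P, `|h (P *+ m) - m%:R ^+ 2 * h P| <= c) /\
          (exists c, forall P, `|h (P *+ m.+1) - m.+1%:R ^+ 2 * h P| <= c) by [].
elim: m => [|m [[c Hc] [c' Hc']]]; split.
- by exists (h 0) => P; rewrite mulr0n expr0n mul0r subr0 ger0_norm.
- by exists 0 => P; rewrite mulr1n expr1n mul1r subrr normr0.
- by exists c'.
exists (c + 2 * c' + 2 * C) => P.
have := Hc P; have := Hc' P; rewrite !ler_norml => /andP[l1 u1] /andP[l0 u0].
have := h_par (P *+ m.+1) P; have := height_par_ge (P *+ m.+1) P.
have E : P *+ m.+1 - P = P *+ m by rewrite mulrSr addrK.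
rewrite E -mulrSr => hl hu; have := C_ge0.
move: l1 u1 l0 u0 hl hu; rewrite -!natr1.
move: (h _) (h _) (h _) (h P) (m%:R : R) => x y z w t ? ? ? ? ? ? ?.
by apply/andP; split; nra.
Qed.

(** In [height_mul] the error depends on the multiplier; here P is fixed and the bound is uniform in
    a, because the first differences of h(aP) grow at most linearly. *)
Lemma height_mul_le P : exists2 D, 0 <= D & forall s a, (0 < s)%N -> (a <= s)%N ->
  h (P *+ a) <= D * s%:R ^+ 2.
Proof.
pose e := h P + C; pose F := h P.
have dE a : h (P *+ a.+1) - h (P *+ a) <= F + 2 * e * a%:R.
  elim: a => [|a IH]; first by rewrite mulr1n mulr0 addr0 /F; have := h_ge0 (P *+ 0); lra.
  have E : P *+ a.+1 - P = P *+ a by rewrite mulrSr addrK.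
  have := h_par (P *+ a.+1) P; rewrite E -mulrSr => hu.
  move: IH hu; rewrite -natr1 /e /F; have := C_ge0; lra.
have fE a : h (P *+ a) <= h 0 + a%:R * F + e * a%:R ^+ 2.
  elim: a => [|a IH]; first by rewrite mulr0n mul0r expr0n mulr0 !addr0.
  have := dE a; have e0 : 0 <= e by rewrite addr_ge0 ?h_ge0.
  rewrite -natr1; nra.
exists (h 0 + F + e) => [|s a s0 as_]; first by rewrite /F /e !addr_ge0 ?h_ge0.
apply: (le_trans (fE a)).
have s1 : 1 <= s%:R :> R by rewrite ler1n.
have aR : (a%:R : R) <= s%:R by rewrite ler_nat.
have a0 : (0 : R) <= a%:R by [].
have h0 := h_ge0 0; have hF : 0 <= F := h_ge0 P.
have he : 0 <= e by rewrite addr_ge0 ?h_ge0.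
have l1 : h 0 <= h 0 * s%:R ^+ 2.
  by apply: ler_peMr => //; apply: exprn_ege1.
have l2 : a%:R * F <= F * s%:R ^+ 2.
  by rewrite mulrC; apply: ler_wpM2l => //; apply: (le_trans aR); rewrite expr2; nra.
have l3 : e * a%:R ^+ 2 <= e * s%:R ^+ 2.
  by apply: ler_wpM2l => //; apply: lerXn2r; rewrite ?nnegrE.
by rewrite (mulrDl (h 0 + F) e) (mulrDl (h 0) F); apply: lerD l3; apply: lerD.
Qed.

Definition count_le (T : R) (M : nat) : Prop :=
  forall s : seq A, uniq s -> (forall P, P \in s -> h P <= T) -> (size s <= M)%N.

Lemma count_leS T T' M : T' <= T -> count_le T M -> count_le T' M.
Proof. by move=> TT cT s us hs; apply: cT => // P /hs hP; apply: le_trans TT. Qed.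

Lemma count_le_exists T : exists M, count_le T M.
Proof.
have [l lP] := h_finite T; exists (size l) => s us hs.
by apply: uniq_leq_size => // P /hs /lP.
Qed.

Definition representatives (r : seq A) n : Prop :=
  forall P, exists2 i, i \in r & exists S, P = i + S *+ n.

Lemma representatives_exp r n j : representatives r n ->
  exists2 r', size r' = (size r ^ j)%N & representatives r' (n ^ j)%N.
Proof.
move=> rP; elim: j => [|j [r' sr' r'P]].
  by exists [:: 0] => // P; exists 0; rewrite ?inE //; exists P; rewrite add0r mulr1n.
exists [seq i + i' *+ n ^ j | i <- r', i' <- r] => [|P].
  by rewrite size_allpairs sr' expnSr.
have [i ir' [S ->]] := r'P P; have [i' i'r [S' ->]] := rP S.
exists (i + i' *+ n ^ j); first exact: allpairs_f.
by exists S'; rewrite mulrnDl addrA -mulrnA expnS mulnC.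
Qed.

(** If P = i + mS then m^2 h(S) <= 2 h(P) + O(1), so h(S) <= T, and P is determined by i and S.
    Raising the height bound by a factor 2k, k the size of r, thus multiplies the count by at most
    k. *)
Lemma count_le_step r m : representatives r m -> (4 * size r <= m ^ 2)%N ->
  exists2 c, 0 <= c & forall T M, 0 <= T -> count_le T M ->
    count_le (2 * (size r)%:R * T - c) (size r * M).
Proof.
move=> rP rm; have [cm cmP] := height_mul m.
have [c1 c10 c1P] : exists2 c1, 0 <= c1 & forall i, i \in r -> h i <= c1.
  elim: (r) => [|i r' [c c0 cP]]; first by exists 0.
  exists (h i + c); first by rewrite addr_ge0 ?h_ge0.
  move=> j; rewrite inE => /orP[/eqP->|/cP jc]; first by rewrite lerDl.
  by rewrite (le_trans jc) // lerDr h_ge0.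
have cm0 : 0 <= cm := le_trans (normr_ge0 _) (cmP 0).
exists (c1 + C + cm) => [|T M T0 cTM s us hs]; first by rewrite !addr_ge0.
have [l lP] := h_finite T; pose L := [seq S <- undup l | h S <= T].
have sL : (size L <= M)%N.
  apply: cTM; first by rewrite filter_uniq ?undup_uniq.
  by move=> P; rewrite mem_filter => /andP[].
apply: (@leq_trans (size r * size L)); last by rewrite leq_mul2l sL orbT.
rewrite -(size_allpairs (fun i S => i + S *+ m)); apply: uniq_leq_size => // P Ps.
have [i ir [S PE]] := rP P; rewrite PE; apply: allpairs_f => //.
have hST : h S <= T; last by rewrite mem_filter hST mem_undup lP.
have := hs _ Ps; have := h_par P i; have -> : P - i = S *+ m by rewrite PE addrC addKr.
have := cmP S; rewrite ler_norml => /andP[+ _]; have := h_ge0 (P + i); have := c1P _ ir.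
have m0 : 0 < m%:R ^+ 2 :> R.
  by rewrite exprn_gt0 // ltr0n; case: (m) rm ir => //; case: (r).
have K4 : 4 * (size r)%:R <= m%:R ^+ 2 :> R by rewrite -natrX -natrM ler_nat.
move=> hi hPi hm hp hP; rewrite -(ler_pM2l m0).
have : 4 * (size r)%:R * T <= m%:R ^+ 2 * T by rewrite ler_wpM2r.
move: hi hPi hm hp hP C_ge0 cm0; rewrite -!mulrA; clear; lra.
Qed.

(* If there were fewer than n^2 cosets of nA then, m = n^j being large, the m-fold
   descent would leave too few points of height <= T to accommodate the
   multiples a P1 + b P2. *)
Theorem index_ge_sq (P1 P2 : A) r n :
  (forall a b : int, P1 *~ a + P2 *~ b = 0 -> a = 0 /\ b = 0) ->
  representatives r n -> (n ^ 2 <= size r)%N.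
Proof.
move=> indep rP; rewrite leqNgt; apply/negP => rn.
have r0 : (0 < size r)%N.
  by have [i + _] := rP 0; case: (r).
(* With k = [size r] and k + 1 <= n^2, the Bernoulli inequality gives (k + 1)^(3k) >= 4 k^(3k). *)
have [j jP] : exists j, (4 * size r ^ j <= (n ^ j) ^ 2)%N.
  have bern j k : ((k.+1) ^ j * k >= k ^ j * (k + j))%N.
    elim: j => [|j IH]; first by rewrite !expn0 addn0.
    rewrite !expnS; have := leq_mul (leqnn k.+1) IH; nia.
  exists (3 * size r)%N; rewrite -expnM [(_ * 2)%N]mulnC (expnM n).
  have : ((size r).+1 ^ (3 * size r) <= (n ^ 2) ^ (3 * size r))%N.
    by rewrite leq_exp2r // muln_gt0 r0.
  move=> H; apply: (leq_trans _ H); rewrite -(leq_pmul2r r0); apply: leq_trans (bern _ _).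
  move: (size r ^ _)%N => X; nia.
have [r' sr' r'P] := representatives_exp j rP; rewrite -sr' in jP.
set K := size r' in jP; have K0 : (0 < K)%N by rewrite /K sr' expn_gt0 r0.
have [c c0 cP] := count_le_step r'P jP.
have [D1 D10 D1P] := height_mul_le P1; have [D2 D20 D2P] := height_mul_le P2.
pose D := 2 * D1 + 2 * D2 + C.
have D0 : 0 <= D by rewrite !addr_ge0 // mulr_ge0.
have [M MP] := count_le_exists (D + c).
have K1 : 1 <= K%:R :> R by rewrite ler1n.
have iter l : count_le (D * (2 * K%:R) ^+ l + c) (K ^ l * M)%N.
  elim: l => [|l IH]; first by rewrite expr0 mulr1 expn0 mul1n.
  rewrite expnS -mulnA; apply: count_leS (cP _ _ _ IH).
    by rewrite exprS; move: c0 K1; rewrite -/K; nra.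
  by rewrite addr_ge0 // mulr_ge0 // exprn_ge0 // mulr_ge0.
(* With s = (2K)^e, the s^2 distinct points aP1 + bP2 with a, b < s have height at most D s^2. This
   gives 4^e <= M, which is contradicted below at e = M. *)
have lat e : ((2 * K) ^ e * (2 * K) ^ e <= K ^ (2 * e) * M)%N.
  set s := ((2 * K) ^ e)%N; have s0 : (0 < s)%N by rewrite expn_gt0 muln_gt0 K0.
  have := iter (2 * e)%N [seq P1 *+ a + P2 *+ b | a <- iota 0 s, b <- iota 0 s].
  rewrite size_allpairs size_iota; apply.
    apply: allpairs_uniq; rewrite ?iota_uniq // => -[a b] [a' b'] _ _ /= /eqP.
    rewrite -subr_eq0 opprD addrACA !pmulrn -!mulrzBr => /eqP/indep[/eqP + /eqP].
    by rewrite !subr_eq0 !eqz_nat => /eqP-> /eqP->.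
  move=> _ /allpairsP[[a b] [/= + + ->]]; rewrite !mem_iota !add0n => /andP[_ /ltnW as_] /andP[_ /ltnW bs].
  have sE : (2 * K%:R) ^+ (2 * e) = s%:R ^+ 2 :> R.
    by rewrite /s natrX natrM -exprM mulnC.
  rewrite sE; have := h_par (P1 *+ a) (P2 *+ b); have := h_ge0 (P1 *+ a - P2 *+ b).
  have := D1P s a s0 as_; have := D2P s b s0 bs.
  have : 1 <= s%:R ^+ 2 :> R by rewrite exprn_ege1 // ler1n.
  rewrite /D; move: c0 C_ge0; nra.
have := lat M; rewrite -expnD addnn -mul2n expnMn => H.
have : (2 ^ (2 * M) <= M)%N.
  by move: H; rewrite mulnC leq_pmul2l // expn_gt0 K0.
by apply/negP; rewrite -ltnNge (leq_trans (ltn_expl M (isT : 1 < 2)%N)) // leq_exp2l // leq_pmull.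
Qed.

End HeightCounting.

(** * The height on E(Q) *)

Section Heights.
Variables (E : int * int) (h : nonsingular rat E).
Local Notation G := (ec h).
Local Notation A := E.1.
Local Notation B := E.2.

(* Primitive homogeneous coordinates of the image of P under x : E -> P^1. *)
Definition xcoord (P : G) : int * int :=
  if ec_pt P is Some (x, _) then (numq x, denq x) else (1, 0).

Lemma xcoord0 : xcoord 0 = (1, 0). Proof. by []. Qed.

Lemma xcoordN P : xcoord (- P) = xcoord P.
Proof. by rewrite /xcoord ec_ptN; case: (ec_pt P) => [[x y]|]. Qed.

Lemma xcoord_bezout P : exists u v : int, u * (xcoord P).1 + v * (xcoord P).2 = 1.
Proof.
rewrite /xcoord; case: (ec_pt P) => [[x y]|] /=; last by exists 1, 0.
have : coprimez (numq x) (denq x) by rewrite coprimezE coprime_num_den.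
by case/coprimezP => -[u v] /= uv; exists u, v.
Qed.

(* Up to a common factor, the forms q3 q4, p3 q4 + q3 p4 and p3 p4 in the
   coordinates of P + Q and P - Q. *)
Definition form0 (u v : int * int) : int := (u.1 * v.2 - v.1 * u.2) ^+ 2.
Definition form1 (u v : int * int) : int :=
  2 * (u.1 * v.1 + A * u.2 * v.2) * (u.1 * v.2 + v.1 * u.2) + 4 * B * u.2 ^+ 2 * v.2 ^+ 2.
Definition form2 (u v : int * int) : int :=
  (u.1 * v.1 - A * u.2 * v.2) ^+ 2 - 4 * B * u.2 * v.2 * (u.1 * v.2 + v.1 * u.2).

Definition sum_diff_rel (u v s t : int * int) : Prop := exists2 l : rat, l != 0 &
  [/\ (form0 u v)%:~R = l * (s.2 * t.2)%:~R,
      (form1 u v)%:~R = l * (s.1 * t.2 + s.2 * t.1)%:~R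
    & (form2 u v)%:~R = l * (s.1 * t.1)%:~R].

Lemma sum_diff_relC u v s t : sum_diff_rel u v s t -> sum_diff_rel u v t s.
Proof.
move=> [l l0 [e0 e1 e2]]; exists l => //; split.
- by rewrite e0 (mulrC t.2).
- by rewrite e1 addrC (mulrC t.1) (mulrC t.2).
- by rewrite e2 (mulrC t.1).
Qed.

Local Notation coord x := (numq x, denq x).
(** [aff1] and [aff2] are the sum and the product of the abscissae of P + Q and P - Q, multiplied by
    (x - y)^2. *)
Definition aff1 (x y : rat) : rat := 2 * (x * y + A%:~R) * (x + y) + 4 * B%:~R.
Definition aff2 (x y : rat) : rat := (x * y - A%:~R) ^+ 2 - 4 * B%:~R * (x + y).

Lemma numq_den (x : rat) : (numq x)%:~R = x * (denq x)%:~R /\ (denq x)%:~R != 0 :> rat.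
Proof. by rewrite numqE intr_eq0 denq_neq0. Qed.

Lemma form_affine (x y : rat) (k := (denq x)%:~R ^+ 2 * (denq y)%:~R ^+ 2 : rat) :
  [/\ (form0 (coord x) (coord y))%:~R = k * (x - y) ^+ 2 :> rat,
     (form1 (coord x) (coord y))%:~R = k * aff1 x y :> rat
   & (form2 (coord x) (coord y))%:~R = k * aff2 x y :> rat].
Proof.
have [nx _] := numq_den x; have [ny _] := numq_den y.
rewrite /form0 /form1 /form2 /aff1 /aff2 /k /=.
rewrite !(rmorphXn, rmorphB, rmorphD, rmorphM) /= nx ny.
by split; ring.
Qed.

Lemma sum_diff_generic (x1 x2 x3 x4 : rat) : x1 != x2 ->
  aff1 x1 x2 = (x1 - x2) ^+ 2 * (x3 + x4) -> aff2 x1 x2 = (x1 - x2) ^+ 2 * (x3 * x4) ->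
  sum_diff_rel (coord x1) (coord x2) (coord x3) (coord x4).
Proof.
move=> x12 a1 a2; have [e0 e1 e2] := form_affine x1 x2.
have [_ d1] := numq_den x1; have [_ d2] := numq_den x2.
have [n3 d3] := numq_den x3; have [n4 d4] := numq_den x4.
exists ((denq x1)%:~R ^+ 2 * (denq x2)%:~R ^+ 2 * (x1 - x2) ^+ 2 / ((denq x3)%:~R * (denq x4)%:~R)).
  by rewrite !mulf_neq0 ?invr_eq0 ?expf_neq0 ?subr_eq0 ?mulf_neq0.
rewrite e0 e1 e2 a1 a2 /= !(rmorphD, rmorphM) /= n3 n4.
by split; field; rewrite d3 d4.
Qed.

(** The case P = Q or P = -Q with 2P nonzero: one of P + Q and P - Q is at infinity, and w is 4
    y^2. *)
Lemma sum_diff_double (x x3 w : rat) : w != 0 -> aff1 x x = w -> aff2 x x = w * x3 ->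
  sum_diff_rel (coord x) (coord x) (coord x3) (1, 0).
Proof.
move=> w0 a1 a2; have [e0 e1 e2] := form_affine x x.
have [_ d1] := numq_den x; have [n3 d3] := numq_den x3.
exists ((denq x)%:~R ^+ 2 * (denq x)%:~R ^+ 2 * w / (denq x3)%:~R).
  by rewrite !mulf_neq0 ?invr_eq0 ?expf_neq0.
rewrite e0 e1 e2 a1 a2 /= !(rmorphD, rmorphM) /= n3.
by split; field.
Qed.

Lemma sum_diff_torsion (x : rat) : aff1 x x = 0 -> aff2 x x != 0 ->
  sum_diff_rel (coord x) (coord x) (1, 0) (1, 0).
Proof.
move=> a1 a2; have [e0 e1 e2] := form_affine x x; have [_ d1] := numq_den x.
exists ((denq x)%:~R ^+ 2 * (denq x)%:~R ^+ 2 * aff2 x x).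
  by rewrite !mulf_neq0 ?expf_neq0.
rewrite e0 e1 e2 a1 /= subrr.
by split; ring.
Qed.

Lemma xcoord_add P Q : sum_diff_rel (xcoord P) (xcoord Q) (xcoord (P + Q)) (xcoord (P - Q)).
Proof.
have [->|P0] := eqVneq P 0.
  exists 1; rewrite ?oner_eq0 // add0r sub0r xcoordN xcoord0 /form0 /form1 /form2 /= !mul1r.
  by split; congr (_%:~R); ring.
have [->|Q0] := eqVneq Q 0.
  exists 1; rewrite ?oner_eq0 // addr0 subr0 xcoord0 /form0 /form1 /form2 /= !mul1r.
  by split; congr (_%:~R); ring.
have [y1 PE _] := ec_pt_neq0 P0; have [y2 QE _] := ec_pt_neq0 Q0.
have := ec_on_curve P; have := ec_on_curve Q.
rewrite /xcoord !ec_ptD ec_ptN PE QE.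
move: (abscissa P) (abscissa Q) => x1 x2 /= C2 C1.
have aff1E x y : y ^+ 2 = x ^+ 3 + A%:~R * x + B%:~R -> aff1 x x = 4 * y ^+ 2.
  by rewrite /aff1 => ->; ring.
case: (eqVneq x1 x2) => [x12|x12] /=; last first.
  have d12 : x2 - x1 != 0 by rewrite subr_eq0 eq_sym.
  (* Sum and product are even in y1 and y2 since Q |-> -Q exchanges the two points; only y1^2 and
     y2^2 remain and the curve equation eliminates them. *)
  apply: sum_diff_generic => //.
    transitivity (2 * y1 ^+ 2 + 2 * y2 ^+ 2 - 2 * (x1 + x2) * (x1 - x2) ^+ 2); last by field.
    by rewrite C1 C2 /aff1; ring.
  transitivity (((y2 ^+ 2 - y1 ^+ 2) ^+ 2
      - 2 * (x1 + x2) * (x1 - x2) ^+ 2 * (y1 ^+ 2 + y2 ^+ 2)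
      + (x1 + x2) ^+ 2 * (x1 - x2) ^+ 4) / (x1 - x2) ^+ 2); last first.
    by field; rewrite d12 -oppr_eq0 opprB.
  by rewrite C1 C2 /aff2; field; rewrite -oppr_eq0 opprB.
rewrite -x12 in C2 *; rewrite opprK.
have dblE : y1 != 0 -> aff2 x1 x1 = 4 * y1 ^+ 2 *
    (((3 * x1 ^+ 2 + A%:~R) / (2 * y1)) ^+ 2 - x1 - x1).
  move=> y10; transitivity ((3 * x1 ^+ 2 + A%:~R) ^+ 2 - 8 * x1 * y1 ^+ 2); last by field.
  by rewrite C1 /aff2; ring.
have [y10|y10] := eqVneq y1 0.
  have y20 : y2 = 0 by apply/eqP; rewrite -[_ == 0]/(true && _) -(expf_eq0 y2 2) C2 -C1 y10 expr0n.
  rewrite y20.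
  rewrite y10 oppr0 !eqxx; apply: sum_diff_torsion.
    by rewrite (aff1E _ _ C1) y10; ring.
  have W0 : x1 ^+ 3 + A%:~R * x1 + B%:~R = 0 by rewrite -C1 y10 expr0n.
  have -> : aff2 x1 x1 = (3 * x1 ^+ 2 + A%:~R) ^+ 2 - 8 * x1 * (x1 ^+ 3 + A%:~R * x1 + B%:~R).
    by rewrite /aff2; ring.
  by rewrite W0 mulr0 subr0 expf_neq0 // (simple_root h).
have : y1 ^+ 2 == y2 ^+ 2 by rewrite C1 C2.
have y1N : (y1 == - y1) = false.
  by rewrite -addr_eq0 -mulr2n -mulr_natl mulf_eq0 (negPf y10).
have w0 : 4 * y1 ^+ 2 != 0 by rewrite mulf_neq0 // expf_neq0.
rewrite eqf_sqr => /orP[/eqP <-|/eqP y12].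
  rewrite y1N eqxx; apply: sum_diff_double w0 (aff1E _ _ C1) (dblE y10).
have -> : y2 = - y1 by rewrite y12 opprK.
rewrite opprK eqxx y1N; apply/sum_diff_relC.
exact: sum_diff_double w0 (aff1E _ _ C1) (dblE y10).
Qed.


Definition sup_norm (u : int * int) : int := Num.max `|u.1| `|u.2|.

(** As in the lemma of Gauss, the product of two primitive forms is primitive, so the common factor
    is an integer and has absolute value at least 1. *)
Lemma sum_diff_integral u v P Q : sum_diff_rel u v (xcoord P) (xcoord Q) ->
  exists2 L : int, L != 0 &
  [/\ form0 u v = L * ((xcoord P).2 * (xcoord Q).2),
      form1 u v = L * ((xcoord P).1 * (xcoord Q).2 + (xcoord P).2 * (xcoord Q).1)
    & form2 u v = L * ((xcoord P).1 * (xcoord Q).1)].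
Proof.
have [a [b ab]] := xcoord_bezout P; have [c [d cd]] := xcoord_bezout Q.
move: (xcoord P) (xcoord Q) ab cd => [p q] [p' q'] /= ab cd [l l0 [e0 e1 e2]].
move: (form0 u v) (form1 u v) (form2 u v) e0 e1 e2 => w0 w1 w2 /= e0 e1 e2.
(* A Bezout relation for the primitive triple (q q', p q' + q p', p p'). *)
pose X := a * c * (p * p') + b * d * (q * q'); pose Y := a * d * (p * q') + b * c * (q * p').
pose al := (X + 2 * Y) * (b * d) + (2 * (a * d) * (b * c) - (a * d) ^+ 2 - (b * c) ^+ 2) * (p * p').
pose be := (a * d) ^+ 2 * (p * q') + (b * c) ^+ 2 * (q * p').
pose ga := (X + 2 * Y) * (a * c).
have bez : al * (q * q') + be * (p * q' + q * p') + ga * (p * p') = 1.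
  transitivity (((a * p + b * q) * (c * p' + d * q')) ^+ 2); last by rewrite ab cd !mulr1.
  by rewrite /al /be /ga /X /Y; ring.
pose L := al * w0 + be * w1 + ga * w2.
have lE : l = L%:~R.
  move: (al) (be) (ga) bez @L => x y z bez L.
  have bezQ : x%:~R * (q * q')%:~R + y%:~R * (p * q' + q * p')%:~R + z%:~R * (p * p')%:~R = 1 :> rat.
    by rewrite -!rmorphM -!rmorphD bez.
  have -> : L%:~R = x%:~R * w0%:~R + y%:~R * w1%:~R + z%:~R * w2%:~R :> rat.
    by rewrite /L !rmorphD !rmorphM.
  by have := congr1 (fun z => l * z) bezQ; rewrite mulr1 => <-; rewrite e0 e1 e2; ring.
exists L; first by move: l0; rewrite lE intr_eq0.
by split; apply: (@intr_inj rat); rewrite [RHS]rmorphM /= -lE.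
Qed.

Lemma normM_le (x y X Y : int) : `|x| <= X -> `|y| <= Y -> `|x * y| <= X * Y.
Proof. by move=> xX yY; rewrite normrM ler_pM. Qed.

Lemma normD_le (x y X Y : int) : `|x| <= X -> `|y| <= Y -> `|x + y| <= X + Y.
Proof. by move=> xX yY; apply: le_trans (ler_normD _ _) (lerD _ _). Qed.

Lemma normB_le (x y X Y : int) : `|x| <= X -> `|y| <= Y -> `|x - y| <= X + Y.
Proof. by move=> xX yY; apply: le_trans (ler_normB _ _) (lerD _ _). Qed.

Lemma sup_norm_le (u : int * int) : `|u.1| <= sup_norm u /\ `|u.2| <= sup_norm u.
Proof. by rewrite /sup_norm !le_max !lexx orbT. Qed.

(** Only the cross terms p q' and q p' need an argument: their sum is at most M and their product at
    most M^2 in absolute value, so each is at most 2M. *)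
Lemma sup_norm_mul (u v : int * int) M :
  `|u.2 * v.2| <= M -> `|u.1 * v.2 + u.2 * v.1| <= M -> `|u.1 * v.1| <= M ->
  sup_norm u * sup_norm v <= 2 * M.
Proof.
case: u v => [p q] [p' q'] /= h0 h1 h2.
have M0 : 0 <= M by apply: le_trans h0.
have cross (x y : int) : `|x + y| <= M -> `|x| * `|y| <= M * M -> `|x| <= 2 * M.
  move=> xy xyM; rewrite leNgt; apply/negP => xM.
  have : `|x| <= `|x + y| + `|y| by rewrite -{1}[x](addrK y) ler_normB.
  by move: xy xyM xM; nia.
have c1 : `|p * q'| <= 2 * M.
  apply: cross h1 _; rewrite -normrM (_ : p * q' * (q * p') = (q * q') * (p * p')); last by ring.
  exact: normM_le.
have c2 : `|q * p'| <= 2 * M.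
  apply: (cross _ (p * q')); first by rewrite addrC.
  rewrite -normrM (_ : q * p' * (p * q') = (q * q') * (p * p')); last by ring.
  exact: normM_le.
move: h0 h2 c1 c2; rewrite !normrM /sup_norm /= /Num.max.
by case: ifP => _; case: ifP => _; lia.
Qed.

Lemma form_le : exists2 c : int, 1 <= c & forall u v,
  let M := c * (sup_norm u ^+ 2 * sup_norm v ^+ 2) in
  [/\ `|form0 u v| <= M, `|form1 u v| <= M & `|form2 u v| <= M].
Proof.
pose c1 : int := 4 * (1 + `|A|) + 4 * `|B|; pose c2 := (1 + `|A|) ^+ 2 + 8 * `|B|.
have c10 : 0 <= c1 by rewrite /c1; lia.
have c20 : 0 <= c2 by rewrite /c2; nia.
exists (4 + c1 + c2) => [|u v M]; first by move: c10 c20; lia.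
rewrite {}/M.
have [u1 u2] := sup_norm_le u; have [v1 v2] := sup_norm_le v.
set H := sup_norm u in u1 u2 *; set K := sup_norm v in v1 v2 *.
have HK : 0 <= H ^+ 2 * K ^+ 2 by rewrite mulr_ge0 ?sqr_ge0.
have n2 : `|2 : int| <= 2 by []. have n4 : `|4 : int| <= 4 by [].
have nA := lexx `|A|; have nB := lexx `|B|.
split.
- apply: (@le_trans _ _ ((H * K + K * H) * (H * K + K * H))).
    rewrite /form0 expr2; apply: normM_le; apply: normB_le; exact: normM_le.
  rewrite (_ : _ * _ = 4 * (H ^+ 2 * K ^+ 2)); last by ring.
  by rewrite ler_wpM2r // -addrA lerDl addr_ge0.
- apply: (@le_trans _ _ (2 * (H * K + `|A| * H * K) * (H * K + K * H) + 4 * `|B| * (H * H) * (K * K))).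
    rewrite /form1; apply: normD_le.
      by do !(apply: normM_le || apply: normD_le).
    by rewrite !expr2; do !apply: normM_le.
  rewrite (_ : _ + _ = c1 * (H ^+ 2 * K ^+ 2)); last by rewrite /c1; ring.
  by rewrite ler_wpM2r // addrAC lerDr addr_ge0.
- apply: (@le_trans _ _ ((H * K + `|A| * H * K) * (H * K + `|A| * H * K)
      + 4 * `|B| * H * K * (H * K + K * H))).
    rewrite /form2 expr2; apply: normB_le.
      by apply: normM_le; apply: normB_le; do !apply: normM_le.
    by do !(apply: normM_le || apply: normD_le).
  rewrite (_ : _ + _ = c2 * (H ^+ 2 * K ^+ 2)); last by rewrite /c2; ring.
  by rewrite ler_wpM2r // lerDr addr_ge0.
Qed.

Lemma sup_norm_parallelogram : exists2 c : int, 1 <= c & forall P Q : G,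
  sup_norm (xcoord (P + Q)) * sup_norm (xcoord (P - Q)) <=
  c * (sup_norm (xcoord P) ^+ 2 * sup_norm (xcoord Q) ^+ 2).
Proof.
have [c c1 cP] := form_le; exists (2 * c) => [|P Q]; first by lia.
have [L L0 [e0 e1 e2]] := sum_diff_integral (xcoord_add P Q).
have := cP (xcoord P) (xcoord Q); rewrite e0 e1 e2 /= => -[b0 b1 b2].
have L1 : 1 <= `|L| by lia.
have red (x M : int) : `|L * x| <= M -> `|x| <= M by rewrite normrM; nia.
by rewrite -mulrA; apply: sup_norm_mul; apply: red.
Qed.

Lemma cubic_form_le (c0 c1 c2 c3 : int) : exists2 c : int, 0 <= c & forall u,
  `|c0 * u.1 ^+ 3 + c1 * u.1 ^+ 2 * u.2 + c2 * u.1 * u.2 ^+ 2 + c3 * u.2 ^+ 3| <=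
  c * sup_norm u ^+ 3.
Proof.
exists (`|c0| + `|c1| + `|c2| + `|c3|) => [|u]; first by lia.
have [u1 u2] := sup_norm_le u; set H := sup_norm u in u1 u2 *.
have n0 := lexx `|c0|; have n1 := lexx `|c1|; have n2 := lexx `|c2|; have n3 := lexx `|c3|.
rewrite !exprS !expr0 !mulr1 !mulrDl !mulrA.
by do !(apply: normM_le || apply: normD_le).
Qed.

Lemma sup_norm_ge1 (P : G) : 1 <= sup_norm (xcoord P).
Proof.
have [a [b]] := xcoord_bezout P; case: (xcoord P) => p q /=; rewrite /sup_norm /=.
have [->|p0] := eqVneq p 0; have [->|q0] := eqVneq q 0; rewrite le_max; lia.
Qed.

(** As p^7 and q^7 are coprime, L divides D, so cancelling L loses at most the factor D already
    present on the right of both equations. *)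
Lemma descent_bound (p q L D x y c K : int) (H := Num.max `|p| `|q|) :
  (exists u v, u * p + v * q = 1) -> 1 <= H -> D != 0 ->
  L * x = D * q ^+ 7 -> L * y = D * p ^+ 7 ->
  `|x| <= c * H ^+ 3 * K -> `|y| <= c * H ^+ 3 * K -> H ^+ 4 <= c * K.
Proof.
move=> pq H1 D0 xE yE xle yle.
have [u [v uv]] : exists u v : int, u * p ^+ 7 + v * q ^+ 7 = 1.
  have /coprimezP[[u v] /= uv] : coprimez (p ^+ 7) (q ^+ 7).
    by rewrite coprimezXl // coprimezXr //; apply/coprimezP; case: pq => a [b]; exists (a, b).
  by exists u, v.
have LD : L * (u * y + v * x) = D.
  by rewrite mulrDr !(mulrCA L) xE yE -[RHS]mulr1 -uv; ring.
have Lle : `|L| <= `|D|.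
  rewrite -LD normrM ler_peMr // -gtz0_ge1 normr_gt0.
  by apply: contraNneq D0 => z; rewrite -LD z mulr0.
have red (z t : int) : L * z = D * t -> `|z| <= c * H ^+ 3 * K -> `|t| <= c * H ^+ 3 * K.
  move=> zt zle; rewrite -(ler_pM2l (_ : 0 < `|D|)) ?normr_gt0 // -normrM -zt normrM.
  by apply: ler_pM.
have Hle : H ^+ 7 <= c * H ^+ 3 * K.
  have [HE|HE] : H = `|q| \/ H = `|p| by rewrite /H /Num.max; case: ifP; [left | right].
    by rewrite [X in X ^+ 7]HE -normrX; apply: red xE xle.
  by rewrite [X in X ^+ 7]HE -normrX; apply: red yE yle.
rewrite -(ler_pM2l (_ : 0 < H ^+ 3)); last by rewrite exprn_gt0 // (lt_le_trans _ H1).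
by rewrite -exprD mulrA (mulrC _ c).
Qed.

(* Bezout identities for the pair of binary quartic forms giving x(2P). *)
Lemma double_resultant (p q : int) : let u := (p, q) in let D := 4 * A ^+ 3 + 27 * B ^+ 2 in
  (12 * p ^+ 2 * q + 16 * A * q ^+ 3) * form2 u u
  - (3 * p ^+ 3 + - 5 * A * p * q ^+ 2 + - 27 * B * q ^+ 3) * form1 u u = 4 * D * q ^+ 7 /\
  (4 * D * p ^+ 3 + - 4 * A ^+ 2 * B * p ^+ 2 * q
    + 4 * A * (3 * A ^+ 3 + 22 * B ^+ 2) * p * q ^+ 2
    + 12 * B * (A ^+ 3 + 8 * B ^+ 2) * q ^+ 3) * form2 u u
  + (A ^+ 2 * B * p ^+ 3 + A * (5 * A ^+ 3 + 32 * B ^+ 2) * p ^+ 2 * q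
    + 2 * B * (13 * A ^+ 3 + 96 * B ^+ 2) * p * q ^+ 2
    + - 3 * A ^+ 2 * (A ^+ 3 + 8 * B ^+ 2) * q ^+ 3) * form1 u u = 4 * D * p ^+ 7.
Proof. by rewrite /form1 /form2 /=; clear; split; ring. Qed.

(** In [double_resultant] the cofactors are cubic, of size H^3, while the left sides are L times
    combinations of the coordinates of x(2P). *)
Lemma sup_norm_double : exists2 c : int, 1 <= c & forall P : G,
  sup_norm (xcoord P) ^+ 4 <= c * sup_norm (xcoord (P + P)).
Proof.
pose D := 4 * A ^+ 3 + 27 * B ^+ 2.
have D0 : D != 0.
  move: h; rewrite /nonsingular mulf_eq0 negb_or => /andP[_]; apply: contraNneq => D0.
  have := congr1 (fun n : int => n%:~R : rat) D0.
  by rewrite /D rmorphD (rmorphM _ 4) (rmorphM _ 27) !rmorphXn /= => ->.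
have [b1 b10 f1P] := cubic_form_le 0 12 0 (16 * A).
have [b2 b20 g1P] := cubic_form_le 3 0 (- 5 * A) (- 27 * B).
have [b3 b30 f2P] := cubic_form_le (4 * D) (- 4 * A ^+ 2 * B) (4 * A * (3 * A ^+ 3 + 22 * B ^+ 2))
  (12 * B * (A ^+ 3 + 8 * B ^+ 2)).
have [b4 b40 g2P] := cubic_form_le (A ^+ 2 * B) (A * (5 * A ^+ 3 + 32 * B ^+ 2))
  (2 * B * (13 * A ^+ 3 + 96 * B ^+ 2)) (- 3 * A ^+ 2 * (A ^+ 3 + 8 * B ^+ 2)).
pose c := 1 + (b1 + b2) + (b3 + b4).
have [c1 c12 c34] : [/\ 1 <= c, b1 + b2 <= c & b3 + b4 <= c].
  by rewrite /c; move: b10 b20 b30 b40; clear; split; lia.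
exists c => // P.
have H1 := sup_norm_ge1 P; have K1 := sup_norm_ge1 (P + P); have bez := xcoord_bezout P.
have [L L0 [_ e1 e2]] := sum_diff_integral (xcoord_add P P).
rewrite subrr xcoord0 /= !(mulr0, mulr1, add0r) in e1 e2.
have [s1 s2] := sup_norm_le (xcoord (P + P)).
move: (f1P (xcoord P)) (g1P (xcoord P)) (f2P (xcoord P)) (g2P (xcoord P)) => {f1P g1P f2P g2P}.
move: (double_resultant (xcoord P).1 (xcoord P).2); cbv zeta; rewrite -surjective_pairing e1 e2.
rewrite !(mul0r, add0r, addr0) -/D.
move: (xcoord (P + P)) K1 s1 s2 => [s t] /= K1 s1 s2.
move: (xcoord P) H1 bez {e1 e2} => [p q] /= H1 bez.
set K := sup_norm (s, t) in K1 s1 s2 *; set H := sup_norm (p, q) in H1 *.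
set f1 := (X in X * _ - _ = _ /\ _); set g1 := (X in _ - X * _ = _ /\ _).
set f2 := (X in _ /\ X * _ + _ = _); set g2 := (X in _ /\ _ + X * _ = _).
rewrite -/f1 -/g1 -/f2 -/g2; move: (f1) (g1) (f2) (g2) => {}f1 {}g1 {}f2 {}g2 [i1 i2] f1P g1P f2P g2P.
have D40 : 4 * D != 0 by rewrite mulf_neq0.
have K0 : 0 <= K by apply: le_trans K1.
have H30 : 0 <= H ^+ 3 by rewrite exprn_ge0 // (le_trans _ H1).
apply: (@descent_bound p q L (4 * D) (f1 * s - g1 * t) (f2 * s + g2 * t)) => //.
- by rewrite mulrBr !(mulrCA L).
- by rewrite mulrDr !(mulrCA L).
- have := normB_le (normM_le f1P s1) (normM_le g1P s2); move/le_trans; apply.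
  by rewrite -!mulrDl !ler_wpM2r.
- have := normD_le (normM_le f2P s1) (normM_le g2P s2); move/le_trans; apply.
  by rewrite -!mulrDl !ler_wpM2r.
Qed.

End Heights.

(** * The logarithmic height *)

Section LogHeight.
Variables (E : int * int) (h : nonsingular rat E) (R : realType).
Local Notation G := (ec h).
Implicit Types P Q : G.

Definition log_height (P : G) : R := ln (sup_norm (xcoord P))%:~R.

Let H_ge1 P : 1 <= (sup_norm (xcoord P))%:~R :> R.
Proof. by rewrite ler1z sup_norm_ge1. Qed.

Let H_gt0 P : 0 < (sup_norm (xcoord P))%:~R :> R.
Proof. exact: lt_le_trans (H_ge1 P). Qed.

Lemma log_height_ge0 P : 0 <= log_height P.
Proof. exact: ln_ge0. Qed.

Lemma log_height_bounds : exists2 C : R, 0 <= C &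
  (forall P Q, log_height (P + Q) + log_height (P - Q) <=
     2 * log_height P + 2 * log_height Q + C) /\
  (forall P, 4 * log_height P - C <= log_height (P + P)).
Proof.
have [c1 c11 parP] := sup_norm_parallelogram h; have [c2 c21 dblP] := sup_norm_double h.
have c1R : 1 <= c1%:~R :> R by rewrite ler1z.
have c2R : 1 <= c2%:~R :> R by rewrite ler1z.
have c1p : 0 < c1%:~R :> R by exact: lt_le_trans c1R.
have c2p : 0 < c2%:~R :> R by exact: lt_le_trans c2R.
have l1 := ln_ge0 c1R; have l2 := ln_ge0 c2R.
exists (ln c1%:~R + ln c2%:~R); first by rewrite addr_ge0.
split=> [P Q|P].
  have := parP P Q; rewrite /log_height.
  move: (H_gt0 (P + Q)) (H_gt0 (P - Q)) (H_gt0 P) (H_gt0 Q).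
  move: (sup_norm _) (sup_norm _) (sup_norm _) (sup_norm _) => q p t s s0 t0 p0 q0.
  rewrite !expr2 -(ler_int R) !intrM => le.
  have : ln (s%:~R * t%:~R : R) <= ln (c1%:~R * (p%:~R * p%:~R * (q%:~R * q%:~R))).
    by rewrite ler_ln ?posrE //; do ?apply: mulr_gt0 => //.
  rewrite !lnM ?posrE //; try (by do !apply: mulr_gt0). lra.
have := dblP P; rewrite /log_height.
move: (H_gt0 (P + P)) (H_gt0 P); move: (sup_norm _) (sup_norm _) => p s s0 p0.
rewrite -[p ^+ 4]/(p * (p * (p * p))) -(ler_int R) !intrM => le.
have : ln (p%:~R * (p%:~R * (p%:~R * p%:~R)) : R) <= ln (c2%:~R * s%:~R).
  by rewrite ler_ln ?posrE //; do ?apply: mulr_gt0 => //.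
rewrite !lnM ?posrE //; try (by do !apply: mulr_gt0). lra.
Qed.

(** Finitely many abscissae are allowed, and each carries at most a chosen point [pt x] and its
    opposite. *)
Lemma log_height_finite T : exists s : seq G, forall P, log_height P <= T -> P \in s.
Proof.
pose N := Num.bound (expR T).
have NP P : log_height P <= T -> sup_norm (xcoord P) <= N%:Z.
  move=> PT; have : (sup_norm (xcoord P))%:~R <= expR T.
    by rewrite -(lnK (H_gt0 P)) ler_expR.
  move=> HT; apply: ltW; rewrite -(ltr_int R).
  exact: le_lt_trans HT (archi_boundP (expR_ge0 T)).
pose ints := [seq (i%:Z - N%:Z) | i <- iota 0 (2 * N).+1].
have intsP (z : int) : `|z| <= N%:Z -> z \in ints.
  move=> zN; apply/mapP; exists (absz (z + N%:Z)); last by lia.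
  by rewrite mem_iota; lia.
have ptE : forall x : rat, exists P : G, (exists2 Q : G, Q != 0 & abscissa Q = x) ->
    P != 0 /\ abscissa P = x.
  move=> x; have [[Q Q0 Qx]|none] := pselect (exists2 Q : G, Q != 0 & abscissa Q = x).
    by exists Q.
  by exists 0.
have [pt ptP] := choice ptE.
pose xs := [seq p%:~R / q%:~R : rat | p <- ints, q <- ints].
exists (0 :: [seq pt x | x <- xs] ++ [seq - pt x | x <- xs]) => P /NP.
have [->|P0] := eqVneq P 0; first by rewrite inE eqxx.
have [y PE _] := ec_pt_neq0 P0; rewrite /xcoord PE => HN.
have xxs : abscissa P \in xs.
  rewrite -[abscissa P]divq_num_den; apply: (allpairs_f (fun p q : int => p%:~R / q%:~R)).
    by apply: intsP; apply: le_trans HN; rewrite /sup_norm le_max lexx.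
  by apply: intsP; apply: le_trans HN; rewrite /sup_norm le_max lexx orbT.
have [|p0 pE] := ptP (abscissa P); first by exists P.
rewrite inE mem_cat; apply/orP; right; apply/orP.
have [PE'|PE'] := abscissa_inj P0 p0 (esym pE); [left|right].
  by apply/mapP; exists (abscissa P).
by apply/mapP; exists (abscissa P).
Qed.

End LogHeight.

(** * Selmer groups, ranks and densities *)

Lemma selmer_size_ge (R : realType) E n : elliptic E -> has_independent_pts E 2 ->
  (0 < n)%N -> ((n ^ 2)%:R%:E <= selmer_size R n E)%E.
Proof.
move=> ellE [P [CP indP]] n0.
have hQ := elliptic_nonsingular rat ellE; have hC := elliptic_nonsingular algC ellE.
pose P1 := Ec hQ (CP ord0); pose P2 := Ec hQ (CP (lift ord0 ord0)).
have add_pt0 (p : ecpoint rat) : add_pt E p None = p by case: p => [[]|].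
have indep a b : P1 *~ a + P2 *~ b = 0 -> a = 0 /\ b = 0.
  move=> /(congr1 (@ec_pt _ _ _)); rewrite ec_ptD !ec_ptMz => ab.
  pose m (i : 'I_2) := if i == ord0 then a else b.
  have H := indP m; split; [apply: (H _ ord0) | apply: (H _ (lift ord0 ord0))];
    by rewrite !big_ord_recl big_ord0 /m /= add_pt0; exact: ab.
have P1inf m : (0 < m)%N -> P1 *+ m != 0.
  move=> m0; apply/eqP => H; have [] := indep m%:Z 0; last by case; lia.
  by rewrite mulr0z addr0 -pmulrn.
(* An infinite Selmer group counts as +oo, and the bound is then trivial. *)
rewrite /selmer_size /counting; case: asboolP => [fin|_]; last by rewrite leey.
have [r sr rP] := selmer_representatives hC n0 P1inf fin.
have [C C0 [par dup]] := log_height_bounds hQ R.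
have := index_ge_sq C0 (@log_height_ge0 _ hQ R) (@log_height_finite _ hQ R) par dup indep rP.
by rewrite sr lee_fin ler_nat.
Qed.

Lemma has_independent_pts0 E : has_independent_pts E 0.
Proof. by exists (fun _ => None); split=> [[]|m _ []]. Qed.

Lemma has_independent_ptsS E r : has_independent_pts E r.+1 -> has_independent_pts E r.
Proof.
move=> [P [CP indP]]; exists (fun i => P (lift ord0 i)); split=> [i|m mP i]; first exact: CP.
pose m' (i : 'I_r.+1) := if unlift ord0 i is Some j then m j else 0.
have := indP m' _ (lift ord0 i); rewrite /m' liftK; apply.
rewrite big_ord_recl unlift_none /= -[RHS]mP.
by apply: eq_bigr => j _; rewrite liftK.
Qed.

Lemma has_independent_pts_le E r r' : (r <= r')%N ->
  has_independent_pts E r' -> has_independent_pts E r.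
Proof.
by move=> /subnK <-; elim: (r' - r)%N => [//|k IH]; rewrite addSn => /has_independent_ptsS.
Qed.

Lemma rank_lt2 E : ~ has_independent_pts E 2 -> has_rank E 0 \/ has_rank E 1.
Proof.
move=> no2; have [h1|no1] := pselect (has_independent_pts E 1); first by right.
by left; split=> //; apply: has_independent_pts0.
Qed.

Lemma has_rank1_odd E : has_rank E 1 -> ~ has_even_rank E.
Proof.
move=> [h1 no2] [r [hr nor] er]; case: r hr nor er => [|[|r]] hr nor er //.
by apply: no2; apply: has_independent_pts_le hr.
Qed.

(** At most n divisors d satisfy d M <= n. The others number at most M, since d |-> n / d maps them
    injectively into the integers below M, and each is at most n. *)
Lemma sum_divisors_le n M : (0 < n)%N ->
  ((\sum_(d <- divisors n) d) * M <= n * n + n * (M * M))%N.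
Proof.
move=> n0; have dP d : d \in divisors n -> [/\ d %| n, 0 < d & d <= n]%N.
  by rewrite -dvdn_divisors // => dn; rewrite dn (dvdn_gt0 n0 dn) dvdn_leq.
have coK d : d \in divisors n -> (n %/ (n %/ d) = d)%N.
  by move=> /dP[dn d0 dle]; rewrite -{1}(divnK dn) mulKn // divn_gt0.
have cnt : (count (fun d => n < d * M)%N (divisors n) <= M)%N.
  rewrite -size_filter -(size_map (fun d => n %/ d)%N) -[X in (_ <= X)%N](size_iota 0).
  apply: uniq_leq_size.
    rewrite map_inj_in_uniq ?filter_uniq ?divisors_uniq // => d e.
    rewrite !mem_filter => /andP[_ dn] /andP[_ en] /(congr1 (divn n)).
    by rewrite !coK.
  move=> _ /mapP[d + ->]; rewrite mem_filter => /andP[dM /dP[dn d0 _]].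
  by rewrite mem_iota /= add0n ltn_divLR // mulnC.
have sz : (size (divisors n) <= n)%N.
  rewrite -[X in (_ <= X)%N](size_iota 1); apply: uniq_leq_size; first exact: divisors_uniq.
  by move=> d /dP[_ d0 dn]; rewrite mem_iota d0 add1n ltnS dn.
have le : (\sum_(d <- divisors n) d * M <=
   \sum_(d <- divisors n) n + \sum_(d <- divisors n) (n < d * M) * (n * M))%N.
  rewrite -big_split /= big_seq [X in (_ <= X)%N]big_seq; apply: leq_sum => d /dP[_ _ dn].
  by case: (leqP (d * M)%N n) => dM; rewrite ?mul1n; [lia | nia].
rewrite big_distrl /= (leq_trans le) // leq_add //.
  by rewrite big_const_seq count_predT iter_addn_0 mulnC leq_mul2r sz orbT.
rewrite -big_distrl /= [leqRHS]mulnCA leq_mul2r; apply/orP; right; apply: leq_trans cnt.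
by rewrite -sum1_count [X in (_ <= X)%N]big_mkcond; apply: leq_sum => d _; case: ifP.
Qed.

(** * Counting curves of bounded height *)

Section Densities.
Variable R : realType.
Implicit Types (X : R) (S : set (int * int)).

Lemma num_below_le X S S' : finite_set (curves_below X) ->
  (forall E, elliptic E -> S E -> S' E) -> num_below X S <= num_below X S'.
Proof.
move=> fin SS'; rewrite ler_nat fsubset_leq_card // -fset_set_sub; [|exact: finite_setIl..].
by move=> E [cE SE]; split=> //; apply: SS' => //; case: cE.
Qed.

Lemma num_belowU X S S' : finite_set (curves_below X) ->
  num_below X (S `|` S') <= num_below X S + num_below X S'.
Proof.
move=> fin; rewrite /num_below setIUr fset_setU; [|exact: finite_setIl..].
by rewrite -natrD ler_nat cardfsU leq_subr.
Qed.

Lemma num_below_disjoint X S S' : finite_set (curves_below X) ->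
  (forall E, elliptic E -> S E -> ~ S' E) ->
  num_below X S + num_below X S' <= num_below X setT.
Proof.
move=> fin dis; rewrite -natrD ler_nat.
have fI T : finite_set (curves_below X `&` T) by exact: finite_setIl.
set F := fset_set (_ `&` S); set F' := fset_set (_ `&` S').
have F0 : #|` (F `&` F')%fset| = 0%N.
  apply/eqP; rewrite cardfs_eq0 -fset_setI //; apply/eqP.
  rewrite (_ : _ `&` _ = set0) ?fset_set0 // -subset0 => E [[cE SE] [_ S'E]].
  by apply: (dis E) => //; case: cE.
have := cardfsU F F'; rewrite F0 subn0 => <-; rewrite -fset_setU // fsubset_leq_card //.
rewrite -fset_set_sub //; first by move=> E [[]|[]].
by rewrite -setIUr; apply: fI.
Qed.

(** [fset_set] of an infinite set is empty, so a nonzero count certifies finiteness. *)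
Lemma finite_curves_below X : num_below X setT != 0 -> finite_set (curves_below X).
Proof.
apply: contra_neqP => inf; rewrite /num_below setIT /fset_set; case: pselect => //.
Qed.

(** A Markov inequality: the sum is a supremum of finite partial sums, among them the one over the
    curves in S. *)
Lemma esum_curves_ge X S (f : int * int -> \bar R) (c : R) : finite_set (curves_below X) ->
  (forall E, elliptic E -> S E -> (c%:E <= f E)%E) ->
  ((c * num_below X S)%:E <= \esum_(E in curves_below X) f E)%E.
Proof.
move=> fin cf; apply: esum_ge; exists (curves_below X `&` S).
  by split; [exact: finite_setIl | exact: subIsetl].
have fI : finite_set (curves_below X `&` S) by exact: finite_setIl.
rewrite fsbig_finite //.
have le (s : seq (int * int)) : {in s, forall E, c%:E <= f E}%E ->
    ((c * (size s)%:R)%:E <= \sum_(E <- s) f E)%E.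
  elim: s => [|E s IH] sf; first by rewrite mulr0 big_nil.
  rewrite big_cons /= -natr1 mulrDr mulr1 addrC EFinD leeD //.
    by apply: sf; rewrite inE eqxx.
  by apply: IH => E' E's; apply: sf; rewrite inE E's orbT.
by apply: le => E; rewrite in_fset_set // => /set_mem[[ellE _] SE]; apply: cf.
Qed.

End Densities.

(** The added 1 leaves room for the averages at finite X to exceed their limit. For n > M^2,
    [sum_divisors_le] bounds (sigma(n) + 1) M by 3 n^2, whence M > 3 / e. *)
Lemma sum_divisors_small (R : realType) (N : set nat) (e : R) : infinite_set N -> 0 < e ->
  exists2 n, N n & (1 < n)%N /\ ((\sum_(d <- divisors n) d)%N%:R + 1) / (n ^ 2)%:R < e.
Proof.
move=> infN e0; pose M := (Num.bound (3 / e)).+1.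
have [n [Nn nM]] : exists n, N n /\ (M * M + 2 <= n)%N.
  apply: contrapT => H; apply: infN; apply: (@sub_finite_set _ _ `I_(M * M + 2)) => [n Nn|].
    by rewrite /= ltnNge; apply/negP => nM; apply: H; exists n.
  exact: finite_II.
exists n => //; have n1 : (1 < n)%N by lia.
split=> //; have n0 : (0 < n)%N by lia.
have M0 : 0 < M%:R :> R by rewrite ltr0n.
have n20 : 0 < (n ^ 2)%:R :> R by rewrite ltr0n expn_gt0 n0.
have eM : 3 < e * M%:R.
  rewrite mulrC -ltr_pdivrMr //; apply: (lt_trans (archi_boundP _)).
    by rewrite divr_ge0 // ltW.
  by rewrite ltr_nat.
have le : ((\sum_(d <- divisors n) d).+1 * M <= 3 * n ^ 2)%N.
  have := sum_divisors_le M n0; rewrite mulSn; move: (\sum_(d <- _) d)%N => s; nia.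
rewrite ltr_pdivrMr // -(ltr_pM2r M0) natr1.
apply: (@le_lt_trans _ _ (3 * (n ^ 2)%:R)); first by rewrite -!natrM ler_nat.
by rewrite mulrAC ltr_pM2r.
Qed.

Section RankDensity.
Variable R : realType.

(* Since a curve with two independent points has at least n^2 elements in its
   n-Selmer group, such curves have upper density at most sigma(n) / n^2. *)
Lemma two_points_density (N : set nat) : infinite_set N ->
  (forall n, N n -> (0 < n)%N /\
     average_is (selmer_size R n) (\sum_(d <- divisors n) d)%N%:R) ->
  (\forall X \near +oo, num_below (X : R) setT != 0) ->
  num_below X (fun E => has_independent_pts E 2) / num_below X setT @[X --> (+oo : set_system R)] -->
    (0 : R).
Proof.
move=> infN avg nz; apply/cvgrPdist_lt => e e0.
have [n Nn [n1 small]] := sum_divisors_small infN e0.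
have [n0] := avg n Nn.
set s := ((\sum_(d <- divisors n) d)%N%:R : R) in small *.
rewrite /average_is => av.
have : \forall X \near +oo, (((num_below (X : R) setT)^-1%:E *
    (\esum_(E in curves_below X) selmer_size R n E)) < (s + 1)%:E)%E.
  have ss : (s%:E < (s + 1)%:E)%E by rewrite lte_fin ltrDl.
  exact: (av _ (open_ereal_lt' ss)).
move=> avlt; near=> X.
have NX : num_below X setT != 0 by near: X.
have Npos : 0 < num_below X setT by rewrite lt_neqAle eq_sym NX /= ler0n.
have fin := finite_curves_below NX.
have n20 : 0 < (n ^ 2)%:R :> R by rewrite ltr0n expn_gt0 n0.
have es := @esum_curves_ge _ X (fun E => has_independent_pts E 2) (selmer_size R n) _ fin
  (fun E ellE E2 => selmer_size_ge R ellE E2 n0).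
have lt : ((num_below X setT)^-1%:E * (\esum_(E in curves_below X) selmer_size R n E) <
   (s + 1)%:E)%E by near: X.
have : (((num_below X setT)^-1 * ((n ^ 2)%:R * num_below X (fun E => has_independent_pts E 2)))%:E
    < (s + 1)%:E)%E.
  by apply: le_lt_trans lt; rewrite EFinM lee_pmul2l // lte_fin invr_gt0.
rewrite lte_fin sub0r normrN ger0_norm ?divr_ge0 //.
rewrite mulrCA mulrC [_^-1 * _]mulrC => lt2.
by apply: lt_trans small; rewrite ltr_pdivlMr.
Unshelve. all: by end_near. Qed.

End RankDensity.

Theorem corollary6 (R : realType) :
  (exists N : set nat, infinite_set N /\
     forall n : nat, N n -> (0 < n)%N /\
       average_is (selmer_size R n) (\sum_(d <- divisors n) d)%N%:R) ->
  percent_have (50 : R) (has_root_number R 1) /\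
  percent_have (50 : R) (has_root_number R (- 1)) ->
  (forall E : int * int, elliptic E ->
     (has_even_rank E <-> has_root_number R 1 E)) ->
  percent_have (50 : R) (fun E => has_rank E 0) /\
  percent_have (50 : R) (fun E => has_rank E 1).
Proof.
move=> [N [infN avg]] [root1 _] parity.
pose S1 := has_root_number R 1; pose H2 E := has_independent_pts E 2.
have half : (50 / 100 : R) = 1 / 2 by lra.
rewrite /percent_have half in root1 *.
(* A quotient by 0 is 0, so a ratio tending to 1/2 eventually has a nonzero denominator. *)
have nz : \forall X \near +oo, num_below (X : R) setT != 0.
  have : 0 < 1 / 2 :> R by lra.
  move=> /(cvgr_gt _ root1); apply: filterS => X; apply: contraTneq => ->.
  by rewrite invr0 mulr0 ltxx.
have dens := two_points_density infN avg nz.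
have rank0P E : elliptic E -> has_rank E 0 -> S1 E.
  by move=> ellE r0; apply/(parity E ellE); exists 0%N.
have rank1P E : elliptic E -> has_rank E 1 -> ~ S1 E.
  by move=> ellE r1 /(parity E ellE); apply: has_rank1_odd.
pose q1 (X : R) := num_below X S1 / num_below X setT; pose q2 (X : R) := num_below X H2 / num_below X setT.
have one : (fun=> 1 : R) @ (+oo : set_system R) --> (1 : R) by apply: cvg_cst.
split.
  (* Rank 0 lies inside [S1], and covers it up to curves in [H2]. *)
  have lo : q1 X - q2 X @[X --> +oo] --> (1 / 2 : R).
    by rewrite -[X in _ --> X]subr0; apply: cvgB root1 dens.
  apply: (squeeze_cvgr _ lo root1); near=> X; have NX : num_below X setT != 0 by near: X.
  have fin := finite_curves_below NX.
  have Ninv : 0 <= (num_below X setT)^-1 by rewrite invr_ge0 ler0n.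
  apply/andP; split; last by apply: ler_wpM2r => //; apply: num_below_le.
  rewrite /q1 /q2 -mulrBl; apply: ler_wpM2r => //; rewrite lerBlDr; apply: le_trans (num_belowU _ _ fin); apply: num_below_le => // E ellE S1E.
  have [h2|/rank_lt2[r0|/(rank1P E ellE)]] := pselect (H2 E); [by right | by left | by []].
(* Rank 1 is disjoint from [S1], and covers its complement up to curves in [H2]. *)
have hi : 1 - q1 X @[X --> +oo] --> (1 / 2 : R).
  have -> : (1 / 2 : R) = 1 - 1 / 2 by lra.
  exact: cvgB one root1.
have lo : 1 - q1 X - q2 X @[X --> +oo] --> (1 / 2 : R).
  by rewrite -[X in _ --> X]subr0; apply: cvgB hi dens.
apply: (squeeze_cvgr _ lo hi); near=> X; have NX : num_below X setT != 0 by near: X.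
have fin := finite_curves_below NX.
have Ninv : 0 <= (num_below X setT)^-1 by rewrite invr_ge0 ler0n.
rewrite /q1 /q2 -(mulfV NX) -!mulrBl; apply/andP; split; apply: ler_wpM2r => //; last first.
  by rewrite lerBrDr; apply: num_below_disjoint => // E; apply: rank1P.
rewrite !lerBlDr; apply: le_trans (lerD (num_belowU _ _ fin) (lexx _)).
apply: le_trans (num_belowU _ _ fin); apply: num_below_le => // E ellE _.
have [s1|ns1] := pselect (S1 E); first by right.
have [h2|/rank_lt2[/(rank0P E ellE)|r1]] := pselect (H2 E); [by left; right | by [] | by left; left].
Unshelve. all: by end_near. Qed.
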